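(* Let $U=u_q\mathfrak{sl}_2$ with $q\in\mathbb C$ a primitive $r$-th root of unity, $r\equiv0\bmod8$, let $H=H(\mathbf m,t,\mathsf d,\mathsf u)$ be a ribbon Nenciu type Hopf algebra with R-matrix $R_H=R_{\mathsf z}R_{\boldsymbol\alpha}$, and let $U\ltimes H$ be their biproduct with R-matrix $R=DR_{\mathsf z}\Theta\bar R_{\boldsymbol\alpha}$, as described in the context. If $\mathcal Z_{(2)}(H\text{-mod})$ is non-semisimple, then so is $\mathcal Z_{(2)}(U\ltimes H\text{-mod})$.
   Context: $r'=r/2$, $r''=r/4$, $\{k\}=q^k-q^{-k}$, $[k]=\{k\}/\{1\}$, $[k]!=[k]\cdots[1]$. $H=H(\mathbf m,t,\mathsf d,\mathsf u)$: let $\mathbf m\in\mathbb Z_{>0}^s$, $\xi_a=\exp(2\pi i/m_a)$, $\mathbb Z_{\mathbf m}=\prod_a\mathbb Z/m_a\mathbb Z$, $\boldsymbol\xi^{\mathbf v}=\prod_a\xi_a^{v_a}$, $\mathbf K^{\mathbf v}=\prod_aK_a^{v_a}$, and let $\mathsf d,\mathsf u$ be integer $t\times s$ matrices with rows $\mathsf d_k,\mathsf u_k$ with $\boldsymbol\xi^{\mathsf d_k\cdot\mathsf u_l}\boldsymbol\xi^{\mathsf d_l\cdot\mathsf u_k}=1$, $\boldsymbol\xi^{\mathsf d_k\cdot\mathsf u_k}=-1$ (entrywise products). $H$ is the Hopf algebra over $\mathbb C$ generated by grouplike $K_1,\dots,K_s$ and $X_1,\dots,X_t$ with $K_a^{m_a}=1$,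 $K_aK_b=K_bK_a$, $K_aX_k=\xi_a^{d_{ka}}X_kK_a$, $X_k^2=0$, $X_lX_k=\boldsymbol\xi^{\mathsf d_k\cdot\mathsf u_l}X_kX_l$, $\Delta(X_k)=1\otimes X_k+X_k\otimes\mathbf K^{\mathsf u_k}$, $S(X_k)=-X_k\mathbf K^{-\mathsf u_k}$, $\epsilon(X_k)=0$. Among the nilpotent generators there are $2t_2$ pairwise anticommuting generators $Z_l^\pm$ ($1\le l\le t_2$), with $Z_l^+,Z_l^-$ of opposite type (rows in $\mathsf d$ and $\mathsf u$ negatives of each other mod $m_a$ in column $a$), and $\Delta(Z_l^\pm)=1\otimes Z_l^\pm+Z_l^\pm\otimes L$ for a grouplike $L$ with $L^2=1$. $H$ has R-matrix $R_H=R_{\mathsf z}R_{\boldsymbol\alpha}$, $R_{\mathsf z}=\frac1{\prod_am_a}\sum_{\mathbf v,\mathbf w\in\mathbb Z_{\mathbf m}}\boldsymbol\xi^{-\mathbf v\cdot\mathbf w}\mathbf K^{\mathbf w}\otimes\mathbf K^{\mathbf v\mathsf z}$ ($\mathsf z$ an integer $s\times s$ matrix), $R_{\boldsymbol\alpha}=\exp\big(\sum_l\alpha_l(Z_l^+\otimes LZ_l^--Z_l^-\otimes LZ_l^+)\big)$, $\alpha_l\in\mathbb C$, and ribbon element $v_H=\exp(-2\sum_l\alpha_lZ_l^+Z_l^-)$ with pivotal element $L$. $U\ltimes H$: generated by $K,E,F$ with $K^{r'}=1$, $E^{r'}=F^{r'}=0$, $KEK^{-1}=q^2E$, $KFK^{-1}=q^{-2}F$,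 $[E,F]=\frac{K-K^{-1}}{q-q^{-1}}$, and by $K_a,X_k$ with the relations of $H$, with cross relations: $K_a$ commutes with $K,E,F$; $KX_k=-X_kK$, $EX_k=-X_kE$, $FX_k=X_kF$. Coproduct: $K,K_a$ grouplike, $\Delta(E)=1\otimes E+E\otimes K$, $\Delta(F)=F\otimes1+K^{-1}\otimes F$, $\Delta(X_k)=1\otimes X_k+X_k\otimes K^{r''}\mathbf K^{\mathsf u_k}$. R-matrix: $R=DR_{\mathsf z}\Theta\bar R_{\boldsymbol\alpha}$ with $D=\frac1{r'}\sum_{b,c=0}^{r'-1}q^{-2bc}K^b\otimes K^c$, $\Theta=\sum_{a=0}^{r'-1}\frac{\{1\}^a}{[a]!}q^{a(a-1)/2}E^a\otimes F^a$, and $\bar R_{\boldsymbol\alpha}$ obtained from $R_{\boldsymbol\alpha}$ by replacing $L$ with $\bar L=K^{r''}L$. For a quasitriangular $(A,R)$, $A$-mod is the braided category of finite-dimensional left modules (braiding $v\otimes w\mapsto R''w\otimes R'v$) and its Müger centre $\mathcal Z_{(2)}(A\text{-mod})$ is the full subcategory of those $V$ whose double braiding with every module is the identity. It is non-semisimple if it contains a module that is not semisimple. *)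

(* Defs.v *)
From HB Require Import structures.
From mathcomp Require Import all_boot all_order all_algebra.
From mathcomp Require Import boolp reals trigo.
From mathcomp Require Import complex mxtens.

Set Implicit Arguments.
Unset Strict Implicit.
Unset Printing Implicit Defensive.

Import Order.TTheory GRing.Theory Num.Theory.
Local Open Scope ring_scope.
Local Open Scope quotient_scope.

Reserved Notation "a ⊗ b" (at level 40, left associativity).

Inductive expr (F I : Type) : Type :=
| Gen of I
| Cst of F
| Add of expr F I & expr F I
| Mul of expr F I & expr F I.
Arguments Gen {F I}.
Arguments Cst {F I}.

HB.instance Definition _ (F I : Type) := gen_eqMixin (expr F I).
HB.instance Definition _ (F I : Type) := gen_choiceMixin (expr F I).

Declare Scope expr_scope.
Delimit Scope expr_scope with X.
Bind Scope expr_scope with expr.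
Notation "x + y" := (Add x y) : expr_scope.
Notation "x * y" := (Mul x y) : expr_scope.
Notation "x ^+ n" := (iter n (Mul x) (Cst 1)) : expr_scope.

Fixpoint emap (F I J : Type) (f : I -> J) (e : expr F I) : expr F J :=
  match e with
  | Gen i => Gen (f i)
  | Cst c => Cst c
  | Add x y => Add (emap f x) (emap f y)
  | Mul x y => Mul (emap f x) (emap f y)
  end.

Record presentation (F : fieldType) := Presentation {
  gens : Type;
  rels : expr F gens -> expr F gens -> Prop
}.

(* The least congruence containing the relations for which the quotient is an
   associative unital F-algebra. *)
Inductive cong (F : fieldType) (P : presentation F) :
  expr F (gens P) -> expr F (gens P) -> Prop :=
| cong_rels x y : rels x y -> cong x y
| cong_refl x : cong x x
| cong_sym x y : cong x y -> cong y x
| cong_trans x y z : cong x y -> cong y z -> cong x z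
| cong_add x x' y y' : cong x x' -> cong y y' -> cong (x + y)%X (x' + y')%X
| cong_mul x x' y y' : cong x x' -> cong y y' -> cong (x * y)%X (x' * y')%X
| cong_addA x y z : cong (x + (y + z))%X (x + y + z)%X
| cong_addC x y : cong (x + y)%X (y + x)%X
| cong_add0 x : cong (Cst 0 + x)%X x
| cong_addN x : cong (Cst (- 1)%R * x + x)%X (Cst 0)
| cong_mulA x y z : cong (x * (y * z))%X (x * y * z)%X
| cong_mul1 x : cong (Cst 1 * x)%X x
| cong_mulDl x y z : cong ((x + y) * z)%X (x * z + y * z)%X
| cong_mulDr x y z : cong (x * (y + z))%X (x * y + x * z)%X
| cong_cstD a b : cong (Cst (a + b)) (Cst a + Cst b)%X
| cong_cstM a b : cong (Cst (a * b)) (Cst a * Cst b)%X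
| cong_cstC a x : cong (Cst a * x)%X (x * Cst a)%X.

Section PresentedAlgebra.
Variables (F : fieldType) (P : presentation F).

Definition congb (x y : expr F (gens P)) : bool := `[< cong x y >].

Lemma congb_equiv : equiv_class_of congb.
Proof.
split=> [x|x y|y x z]; first exact/asboolP/cong_refl.
- by apply/asboolP/asboolP => /cong_sym.
- by move=> /asboolP xy /asboolP yz; apply/asboolP/(cong_trans xy yz).
Qed.

Canonical congb_equivRel := EquivRelPack congb_equiv.

Definition palg : Type := {eq_quot congb}.

HB.instance Definition _ := Choice.on palg.
HB.instance Definition _ := EqQuotient.on palg.

Lemma palgP (x y : expr F (gens P)) : cong x y <-> \pi_palg x = \pi_palg y.
Proof. by split=> [xy|/eqmodP /asboolP//]; apply/eqmodP/asboolP. Qed.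

Definition gen (i : gens P) : palg := \pi_palg (Gen i).
Definition cst (c : F) : palg := \pi_palg (Cst c).
Definition padd (x y : palg) : palg := \pi_palg (repr x + repr y)%X.
Definition pmul (x y : palg) : palg := \pi_palg (repr x * repr y)%X.
Definition popp (x : palg) : palg := \pi_palg (Cst (- 1)%R * repr x)%X.
Definition pscale (c : F) (x : palg) : palg := \pi_palg (Cst c * repr x)%X.

Lemma cong_repr (x : expr F (gens P)) : cong (repr (\pi_palg x)) x.
Proof. by apply/palgP; rewrite reprK. Qed.

Lemma palg_piD x y : padd (\pi_palg x) (\pi_palg y) = \pi_palg (x + y)%X.
Proof. by apply/palgP/cong_add; apply: cong_repr. Qed.
Lemma palg_piM x y : pmul (\pi_palg x) (\pi_palg y) = \pi_palg (x * y)%X.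
Proof. by apply/palgP/cong_mul; apply: cong_repr. Qed.
Lemma palg_piN x : popp (\pi_palg x) = \pi_palg (Cst (- 1)%R * x)%X.
Proof. by apply/palgP/cong_mul; [apply: cong_refl|apply: cong_repr]. Qed.
Lemma palg_piZ c x : pscale c (\pi_palg x) = \pi_palg (Cst c * x)%X.
Proof. by apply/palgP/cong_mul; [apply: cong_refl|apply: cong_repr]. Qed.

Lemma palg_ind (Q : palg -> Prop) : (forall e, Q (\pi_palg e)) -> forall x, Q x.
Proof. by move=> Qpi x; rewrite -[x]reprK. Qed.

Let addA : associative padd.
Proof.
elim/palg_ind=> x; elim/palg_ind=> y; elim/palg_ind=> z.
by rewrite !palg_piD; apply/palgP/cong_addA.
Qed.
Let addC : commutative padd.
Proof.
by elim/palg_ind=> x; elim/palg_ind=> y; rewrite !palg_piD; apply/palgP/cong_addC.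
Qed.
Let add0 : left_id (cst 0) padd.
Proof. by elim/palg_ind=> x; rewrite palg_piD; apply/palgP/cong_add0. Qed.
Let addN : left_inverse (cst 0) popp padd.
Proof. by elim/palg_ind=> x; rewrite palg_piN palg_piD; apply/palgP/cong_addN. Qed.

HB.instance Definition _ := GRing.isZmodule.Build palg addA addC add0 addN.

Let mulA : associative pmul.
Proof.
elim/palg_ind=> x; elim/palg_ind=> y; elim/palg_ind=> z.
by rewrite !palg_piM; apply/palgP/cong_mulA.
Qed.
Let mul1 : left_id (cst 1) pmul.
Proof. by elim/palg_ind=> x; rewrite palg_piM; apply/palgP/cong_mul1. Qed.
Let mulr1' : right_id (cst 1) pmul.
Proof.
elim/palg_ind=> x; rewrite palg_piM; apply/palgP.
exact: cong_trans (cong_sym (cong_cstC _ _)) (cong_mul1 _).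
Qed.
Let mulDl : left_distributive pmul padd.
Proof.
elim/palg_ind=> x; elim/palg_ind=> y; elim/palg_ind=> z.
by rewrite !(palg_piM, palg_piD); apply/palgP/cong_mulDl.
Qed.
Let mulDr : right_distributive pmul padd.
Proof.
elim/palg_ind=> x; elim/palg_ind=> y; elim/palg_ind=> z.
by rewrite !(palg_piM, palg_piD); apply/palgP/cong_mulDr.
Qed.

HB.instance Definition _ :=
  GRing.Zmodule_isPzRing.Build palg mulA mul1 mulr1' mulDl mulDr.

Let scaleA a b x : pscale a (pscale b x) = pscale (a * b) x.
Proof.
elim/palg_ind: x => x; rewrite !palg_piZ; apply/palgP.
apply: cong_trans (cong_mulA _ _ _) _.
by apply: cong_mul (cong_sym (cong_cstM _ _ _)) (cong_refl _).
Qed.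
Let scale1 : left_id 1 pscale.
Proof. by elim/palg_ind=> x; rewrite palg_piZ; apply/palgP/cong_mul1. Qed.
Let scaleDr : right_distributive pscale +%R.
Proof.
move=> c; elim/palg_ind=> x; elim/palg_ind=> y.
by rewrite -[_ + _]/(padd _ _) -[RHS]/(padd _ _) !(palg_piD, palg_piZ);
  apply/palgP/cong_mulDr.
Qed.
Let scaleDl x : {morph pscale^~ x : a b / a + b}.
Proof.
elim/palg_ind: x => x a b; rewrite -[RHS]/(padd _ _) !(palg_piZ, palg_piD).
apply/palgP; apply: cong_trans (cong_mulDl _ _ _).
by apply: cong_mul (cong_cstD _ _ _) (cong_refl _).
Qed.

HB.instance Definition _ :=
  GRing.Zmodule_isLmodule.Build F palg scaleA scale1 scaleDr scaleDl.

(* [lift eta h] is the algebra map sending the generator [i] to [h i] and the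
   scalar [c] to [eta c].  It is computed on a representative, so it is
   meaningful when [h] satisfies the relations; see [lift_pi]. *)
Section Lift.
Variables (B : pzRingType) (eta : F -> B) (h : gens P -> B).

Fixpoint eval (e : expr F (gens P)) : B :=
  match e with
  | Gen i => h i
  | Cst c => eta c
  | Add x y => eval x + eval y
  | Mul x y => eval x * eval y
  end.

Definition lift (x : palg) : B := eval (repr x).

Hypothesis etaD : {morph eta : a b / a + b}.
Hypothesis etaM : {morph eta : a b / a * b}.
Hypothesis eta1 : eta 1 = 1.
Hypothesis etaC : forall c b, eta c * b = b * eta c.
Hypothesis hP : forall x y, rels x y -> eval x = eval y.

Lemma eval_cong x y : cong x y -> eval x = eval y.
Proof.
have eta0 : eta 0 = 0 by apply: (addIr (eta 0)); rewrite -etaD !add0r.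
have etaN1 : eta (- 1) = - 1.
  by apply: (addIr (eta 1)); rewrite -etaD addNr eta0 eta1 addNr.
elim=> //=; try by move=> *; congruence.
- by move=> *; rewrite addrA.
- by move=> *; rewrite addrC.
- by move=> *; rewrite eta0 add0r.
- by move=> *; rewrite etaN1 mulN1r addNr eta0.
- by move=> *; rewrite mulrA.
- by move=> *; rewrite eta1 mul1r.
- by move=> *; rewrite mulrDl.
- by move=> *; rewrite mulrDr.
Qed.

Lemma lift_pi e : lift (\pi_palg e) = eval e.
Proof. exact/eval_cong/cong_repr. Qed.

End Lift.
End PresentedAlgebra.

Inductive tens_rel (F : fieldType) (P Q : presentation F) :
  expr F (gens P + gens Q) -> expr F (gens P + gens Q) -> Prop :=
| tens_inl x y : rels x y -> tens_rel (emap inl x) (emap inl y)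
| tens_inr x y : rels x y -> tens_rel (emap inr x) (emap inr y)
| tens_comm i j :
    tens_rel (Gen (inl i) * Gen (inr j))%X (Gen (inr j) * Gen (inl i))%X.

(* [palg (tens P Q)] is the tensor product of the algebras [palg P], [palg Q]. *)
Definition tens (F : fieldType) (P Q : presentation F) : presentation F :=
  Presentation (@tens_rel F P Q).

Section Tensor.
Variables (F : fieldType) (P Q : presentation F).

Definition tin1 : palg P -> palg (tens P Q) :=
  lift (@cst F (tens P Q)) (fun i => gen (inl i : gens (tens P Q))).
Definition tin2 : palg Q -> palg (tens P Q) :=
  lift (@cst F (tens P Q)) (fun j => gen (inr j : gens (tens P Q))).
Definition tensor (a : palg P) (b : palg Q) : palg (tens P Q) := tin1 a * tin2 b.

(* a ⊗ b |-> f a * g b, for algebra maps f and g with commuting images *)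
Definition tlift (T : presentation F) (f : palg P -> palg T)
    (g : palg Q -> palg T) : palg (tens P Q) -> palg T :=
  lift (@cst F T)
    (fun i : gens (tens P Q) =>
       match i with inl i => f (gen i) | inr j => g (gen j) end).
End Tensor.
Notation "a ⊗ b" := (tensor a b) : ring_scope.

Definition tflip (F : fieldType) (P : presentation F) :
  palg (tens P P) -> palg (tens P P) := tlift (@tin2 F P P) (@tin1 F P P).

Section Hopf.
Variables (F : fieldType) (P : presentation F).
Local Notation A := (palg P).
Local Notation A2 := (palg (tens P P)).
Local Notation A3 := (palg (tens (tens P P) P)).

Definition leg1 (a : A) : A3 := tin1 P (tin1 P a).
Definition leg2 (a : A) : A3 := tin1 P (tin2 P a).
Definition leg3 (a : A) : A3 := tin2 (tens P P) a.

Record hopf := Hopf {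
  coprod : {rmorphism A -> A2};
  coprodZ : scalable coprod;
  counit : {rmorphism A -> F};
  counitZ : forall c a, counit (c *: a) = c * counit a;
  antip : {linear A -> A};
  coprodA : forall a,
    tlift (tin1 P \o coprod) leg3 (coprod a) =
    tlift leg1 (tlift leg2 leg3 \o coprod) (coprod a);
  counitl : forall a, tlift (fun x => cst P (counit x)) id (coprod a) = a;
  counitr : forall a, tlift id (fun x => cst P (counit x)) (coprod a) = a;
  antipl : forall a (p : seq (A * A)), coprod a = \sum_(x <- p) x.1 ⊗ x.2 ->
    \sum_(x <- p) antip x.1 * x.2 = cst P (counit a);
  antipr : forall a (p : seq (A * A)), coprod a = \sum_(x <- p) x.1 ⊗ x.2 ->
    \sum_(x <- p) x.1 * antip x.2 = cst P (counit a)
}.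

Record quasitriangular := Quasitriangular {
  qt_hopf :> hopf;
  Rmx : A2;
  Rmx_unit : exists R' : A2, Rmx * R' = 1 /\ R' * Rmx = 1;
  Rmx_coprod : forall a, Rmx * coprod qt_hopf a = tflip (coprod qt_hopf a) * Rmx;
  Rmx_hexl : tlift (tin1 P \o coprod qt_hopf) leg3 Rmx =
    tlift leg1 leg3 Rmx * tlift leg2 leg3 Rmx;
  Rmx_hexr : tlift leg1 (tlift leg2 leg3 \o coprod qt_hopf) Rmx =
    tlift leg1 leg3 Rmx * tlift leg1 leg2 Rmx
}.

Definition drinfeld_element (Q : quasitriangular) (u : A) : Prop :=
  exists2 p : seq (A * A), Rmx Q = \sum_(x <- p) x.1 ⊗ x.2 &
    u = \sum_(x <- p) antip Q x.2 * x.1.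

(* [v] is a ribbon element, and [g = u v^-1] is its pivotal element. *)
Definition ribbon_with_pivot (Q : quasitriangular) (v g : A) : Prop :=
  (forall a, v * a = a * v) /\
  antip Q v = v /\
  counit Q v = 1 /\
  tflip (Rmx Q) * Rmx Q * coprod Q v = v ⊗ v /\
  exists2 u, drinfeld_element Q u & v ^+ 2 = u * antip Q u /\ u = g * v.

Definition grouplike (H : hopf) (g : A) : Prop :=
  coprod H g = g ⊗ g /\ counit H g = 1.
End Hopf.

Section Modules.
Variables (F : fieldType) (P : presentation F).

(* The left module F^n of column vectors. *)
Record fdmod := FdMod {
  mdim : nat;
  mact : {rmorphism palg P -> 'M[F]_mdim};
  mactZ : scalable mact
}.

Definition submodule (V : fdmod) (U : {vspace 'cV[F]_(mdim V)}) : Prop :=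
  forall a x, x \in U -> mact V a *m x \in U.

Definition simple_submodule (V : fdmod) (U : {vspace 'cV[F]_(mdim V)}) : Prop :=
  [/\ submodule U, U != 0%VS &
    forall W : {vspace 'cV[F]_(mdim V)},
      submodule W -> (W <= U)%VS -> W = 0%VS \/ W = U].

Definition semisimple (V : fdmod) : Prop :=
  exists (k : nat) (U : 'I_k -> {vspace 'cV[F]_(mdim V)}),
    [/\ forall i, simple_submodule (U i),
        directv (\sum_i U i) & (\sum_i U i)%VS = fullv].

(* The action of [palg (tens P P)] on V ⊗ W, where v ⊗ w is [v *t w]. *)
Definition tens_act (V W : fdmod) :
    palg (tens P P) -> 'M[F]_(mdim V * mdim W) :=
  lift (@scalar_mx F (mdim V * mdim W))
    (fun i : gens (tens P P) =>
       match i with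
       | inl i => mact V (gen i) *t 1%:M
       | inr j => 1%:M *t mact W (gen j)
       end).

Definition swap_mx (n p : nat) : 'M[F]_(p * n, n * p) :=
  \matrix_(k, l) (((mxtens_unindex k).1 == (mxtens_unindex l).2) &&
                  ((mxtens_unindex k).2 == (mxtens_unindex l).1))%:R.

Definition braiding (Q : quasitriangular P) (V W : fdmod) :
    'M[F]_(mdim W * mdim V, mdim V * mdim W) :=
  swap_mx (mdim V) (mdim W) *m tens_act V W (Rmx Q).

Definition mueger (Q : quasitriangular P) (V : fdmod) : Prop :=
  forall W : fdmod, braiding Q W V *m braiding Q V W = 1%:M.

Definition mueger_nonsemisimple (Q : quasitriangular P) : Prop :=
  exists2 V : fdmod, mueger Q V & ~ semisimple V.
End Modules.

Section Nenciu.
Variable R : realType.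
Local Notation C := R[i].

Definition xi_root (n : nat) : C :=
  (cos (2 * pi / n%:R) +i* sin (2 * pi / n%:R))%C.

Variables (s t : nat) (m : 'I_s -> nat) (d u : 'M[int]_(t, s)).

Definition bxi (v : 'rV[int]_s) : C := \prod_a xi_root (m a) ^ v 0 a.

Definition had (v w : 'rV[int]_s) : 'rV[int]_s := map2_mx *%R v w.

(* K^v; the exponent of K_a is reduced modulo m_a, as K_a^{m_a} = 1. *)
Definition Kpow (A : pzRingType) (K : 'I_s -> A) (v : 'rV[int]_s) : A :=
  \prod_a K a ^+ absz (v 0%R a %% (m a)%:Z)%Z.

Inductive ngen := nK of 'I_s | nX of 'I_t.

Inductive nenciu_rel : expr C ngen -> expr C ngen -> Prop :=
| nrel_order a : nenciu_rel (Gen (nK a) ^+ m a)%X (Cst 1)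
| nrel_KK a b :
    nenciu_rel (Gen (nK a) * Gen (nK b))%X (Gen (nK b) * Gen (nK a))%X
| nrel_KX a k :
    nenciu_rel (Gen (nK a) * Gen (nX k))%X
      (Cst (xi_root (m a) ^ d k a)%R * (Gen (nX k) * Gen (nK a)))%X
| nrel_X2 k : nenciu_rel (Gen (nX k) ^+ 2)%X (Cst 0)
| nrel_XX k l :
    nenciu_rel (Gen (nX l) * Gen (nX k))%X
      (Cst (bxi (had (row k d) (row l u))) * (Gen (nX k) * Gen (nX l)))%X.

Definition nenciu : presentation C := Presentation nenciu_rel.

Definition HK (a : 'I_s) : palg nenciu := gen (nK a : gens nenciu).
Definition HX (k : 'I_t) : palg nenciu := gen (nX k : gens nenciu).

Definition nenciu_matrices : Prop :=
  (forall k l, bxi (had (row k d) (row l u)) * bxi (had (row l d) (row k u)) = 1)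
  /\ (forall k, bxi (had (row k d) (row k u)) = -1).

Definition nenciu_hopf (H : hopf nenciu) : Prop :=
  [/\ forall a, grouplike H (HK a),
      forall k, coprod H (HX k) = 1 ⊗ HX k + HX k ⊗ Kpow HK (row k u),
      forall k, antip H (HX k) = - HX k * Kpow HK (- row k u) &
      forall k, counit H (HX k) = 0].

Variables (q : C) (r : nat).
Local Notation r' := (r %/ 2)%N.
Local Notation r'' := (r %/ 4)%N.

Definition qbrace (k : nat) : C := q ^+ k - q ^- k.
Definition qint (k : nat) : C := qbrace k / qbrace 1.
Definition qfact (k : nat) : C := \prod_(1 <= j < k.+1) qint j.

Inductive bgen := bK | bE | bF | bH of ngen.

Local Notation gK := (Gen bK).
Local Notation gE := (Gen bE).
Local Notation gF := (Gen bF).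
Local Notation gKinv := (gK ^+ (r' - 1))%X.
Local Notation gKa a := (Gen (bH (nK a))).
Local Notation gX k := (Gen (bH (nX k))).

Inductive biproduct_rel : expr C bgen -> expr C bgen -> Prop :=
| brel_K : biproduct_rel (gK ^+ r')%X (Cst 1)
| brel_E : biproduct_rel (gE ^+ r')%X (Cst 0)
| brel_F : biproduct_rel (gF ^+ r')%X (Cst 0)
| brel_KE : biproduct_rel (gK * gE * gKinv)%X (Cst (q ^+ 2)%R * gE)%X
| brel_KF : biproduct_rel (gK * gF * gKinv)%X (Cst (q ^- 2)%R * gF)%X
| brel_EF :
    biproduct_rel (gE * gF + Cst (- 1)%R * (gF * gE))%X
      (Cst ((q - q^-1)^-1)%R * (gK + Cst (- 1)%R * gKinv))%X
| brel_H x y : nenciu_rel x y -> biproduct_rel (emap bH x) (emap bH y)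
| brel_KaK a : biproduct_rel (gKa a * gK)%X (gK * gKa a)%X
| brel_KaE a : biproduct_rel (gKa a * gE)%X (gE * gKa a)%X
| brel_KaF a : biproduct_rel (gKa a * gF)%X (gF * gKa a)%X
| brel_KX k : biproduct_rel (gK * gX k)%X (Cst (- 1)%R * (gX k * gK))%X
| brel_EX k : biproduct_rel (gE * gX k)%X (Cst (- 1)%R * (gX k * gE))%X
| brel_FX k : biproduct_rel (gF * gX k)%X (gX k * gF)%X.

Definition biproduct : presentation C := Presentation biproduct_rel.

Definition UK : palg biproduct := gen (bK : gens biproduct).
Definition UE : palg biproduct := gen (bE : gens biproduct).
Definition UF : palg biproduct := gen (bF : gens biproduct).

Definition Hincl : palg nenciu -> palg biproduct :=
  lift (@cst _ biproduct) (fun i : gens nenciu => gen (bH i : gens biproduct)).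

Definition UHK (a : 'I_s) : palg biproduct := Hincl (HK a).
Definition UHX (k : 'I_t) : palg biproduct := Hincl (HX k).

Definition biproduct_hopf (H : hopf biproduct) : Prop :=
  [/\ grouplike H UK,
      forall a, grouplike H (UHK a),
      coprod H UE = 1 ⊗ UE + UE ⊗ UK,
      coprod H UF = UF ⊗ 1 + UK ^+ (r' - 1) ⊗ UF &
      forall k, coprod H (UHX k) =
        1 ⊗ UHX k + UHX k ⊗ (UK ^+ r'' * Kpow UHK (row k u))].

(* The exponential of [x], provided [x ^+ n = 0]. *)
Definition nexp (P : presentation C) (n : nat) (x : palg P) : palg P :=
  \sum_(j < n) (j`!%:R)^-1 *: x ^+ j.

Definition zvec (v : {dffun forall a : 'I_s, 'I_(m a)}) : 'rV[int]_s :=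
  \row_a (v a : nat)%:Z.

Definition Rz (P : presentation C) (K : 'I_s -> palg P) (z : 'M[int]_s) :
    palg (tens P P) :=
  (\prod_a (m a)%:R)^-1 *:
  \sum_(v : {dffun forall a : 'I_s, 'I_(m a)})
  \sum_(w : {dffun forall a : 'I_s, 'I_(m a)})
    bxi (- had (zvec v) (zvec w)) *:
      (Kpow K (zvec w) ⊗ Kpow K (zvec v *m z)).

(* The exponent is a sum of 2 t2 commuting elements of square zero. *)
Definition Ralpha (P : presentation C) (t2 : nat) (alpha : 'I_t2 -> C)
    (Zp Zm : 'I_t2 -> palg P) (L : palg P) : palg (tens P P) :=
  nexp (2 * t2).+1
    (\sum_l alpha l *: (Zp l ⊗ (L * Zm l) - Zm l ⊗ (L * Zp l))).

(* The exponent is a sum of t2 commuting elements of square zero. *)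
Definition vH (t2 : nat) (alpha : 'I_t2 -> C)
    (Zp Zm : 'I_t2 -> palg nenciu) : palg nenciu :=
  nexp t2.+1 (- 2%:R *: \sum_l alpha l *: (Zp l * Zm l)).

Definition Dmx : palg (tens biproduct biproduct) :=
  (r'%:R)^-1 *: \sum_(b < r') \sum_(c < r')
    q ^- (2 * b * c) *: (UK ^+ b ⊗ UK ^+ c).

Definition Theta : palg (tens biproduct biproduct) :=
  \sum_(a < r') (qbrace 1 ^+ a / qfact a * q ^+ 'C(a, 2)) *: (UE ^+ a ⊗ UF ^+ a).

(* X_(Zp l) and X_(Zm l) play the roles of Z_l^+ and Z_l^-. *)
Definition Z_generators (H : hopf nenciu) (t2 : nat) (Zp Zm : 'I_t2 -> 'I_t)
    (L : palg nenciu) : Prop :=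
  let Z (i : 'I_t2 + 'I_t2) := match i with inl l => Zp l | inr l => Zm l end in
  [/\ injective Z,
      forall i j, i != j -> HX (Z i) * HX (Z j) = - (HX (Z j) * HX (Z i)),
      forall l a, (d (Zm l) a = - d (Zp l) a %[mod (m a)%:Z])%Z /\
                  (u (Zm l) a = - u (Zp l) a %[mod (m a)%:Z])%Z,
      grouplike H L /\ L ^+ 2 = 1 &
      forall i, coprod H (HX (Z i)) = 1 ⊗ HX (Z i) + HX (Z i) ⊗ L].

(* H is a ribbon Hopf algebra with R-matrix R_z R_alpha, ribbon element v_H
   and pivotal element L. *)
Definition nenciu_ribbon (H : quasitriangular nenciu) (z : 'M[int]_s)
    (t2 : nat) (Zp Zm : 'I_t2 -> 'I_t) (L : palg nenciu) (alpha : 'I_t2 -> C) :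
    Prop :=
  [/\ nenciu_hopf H,
      Z_generators H Zp Zm L,
      Rmx H = Rz HK z * Ralpha alpha (HX \o Zp) (HX \o Zm) L &
      ribbon_with_pivot H (vH alpha (HX \o Zp) (HX \o Zm)) L].

Definition biproduct_quasitriangular (UH : quasitriangular biproduct)
    (z : 'M[int]_s) (t2 : nat) (Zp Zm : 'I_t2 -> 'I_t) (L : palg nenciu)
    (alpha : 'I_t2 -> C) : Prop :=
  biproduct_hopf UH /\
  Rmx UH = Dmx * Rz UHK z * Theta *
    Ralpha alpha (UHX \o Zp) (UHX \o Zm) (UK ^+ r'' * Hincl L).

End Nenciu.

(* Main.v *)
Require Import Defs.
From HB Require Import structures.
From mathcomp Require Import all_boot all_order all_algebra.
From mathcomp Require Import boolp reals.
From mathcomp Require Import complex mxtens.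

(* An H-module V extends to a U ⋉ H-module V' = V ⊕ V on which E and F act by
   zero, K acts by diag(1, -1), the K_a diagonally and the X_k antidiagonally.

   Theta acts trivially when one factor is V', and D acts on W ⊗ V' through
   1 ⊗ p_+ + K^{r''} ⊗ p_-, with p_± the projections on the two copies of V.
   As r'' is even, K^{r''} is an involution commuting with the action of H on W,
   so X_k |-> K^{r''} X_k defines another H-module structure W^tw on W.  Moving D
   through the R-matrix turns the double braiding of V' and W into the double
   braiding over H of V' and W^tw.

   As an H-module V' is the sum of V and of V with the sign of all X_k changed.
   The R-matrix of H only involves products X_k ⊗ X_l, so this sign can be moved
   to the other factor; hence V' is transparent when V is.

   If V' is semisimple, an equivariant projection of V' on N ⊕ N, for N a
   submodule of V, induces one of V on N. *)

Set Implicit Arguments.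
Unset Strict Implicit.
Unset Printing Implicit Defensive.

Import Order.TTheory GRing.Theory Num.Theory.
Local Open Scope ring_scope.
Local Open Scope quotient_scope.

(** * Presented algebras and their matrix representations *)

Section PresentedAlgebra.
Variables (F : fieldType) (P : presentation F).
Local Notation A := (palg P).
Local Notation pi e := (\pi_A e : A).

Lemma piD x y : pi (x + y)%X = pi x + pi y.
Proof. by rewrite -palg_piD. Qed.

Lemma piM x y : pi (x * y)%X = pi x * pi y.
Proof. by rewrite -palg_piM. Qed.

Lemma scale_pi c x : c *: pi x = pi (Cst c * x)%X.
Proof. exact: palg_piZ. Qed.

Lemma pi_cst c : pi (Cst c) = c *: (1 : A).
Proof.
rewrite -[1]/(pi (Cst 1)) scale_pi -[in LHS](mulr1 c).
exact/palgP/cong_cstM.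
Qed.

Lemma cst1 : cst P 1 = 1. Proof. by []. Qed.

Lemma cstE c : cst P c = c *: (1 : A). Proof. exact: pi_cst. Qed.

Lemma cst_comm c (x : A) : cst P c * x = x * cst P c.
Proof. by elim/palg_ind: x => x; rewrite -!piM; apply/palgP/cong_cstC. Qed.

Lemma scalerAl_palg c (x y : A) : c *: (x * y) = (c *: x) * y.
Proof.
elim/palg_ind: x => x; elim/palg_ind: y => y.
by rewrite -piM !scale_pi -piM; apply/palgP/cong_mulA.
Qed.

Lemma cst_scale c (x : A) : cst P c * x = c *: x.
Proof. by rewrite cstE -scalerAl_palg mul1r. Qed.

Lemma cstD : {morph @cst F P : a b / a + b}.
Proof. by move=> a b; rewrite !cstE scalerDl. Qed.

Lemma cstM : {morph @cst F P : a b / a * b}.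
Proof. by move=> a b; rewrite cst_scale !cstE scalerA. Qed.

Section Representation.
Variables (n : nat) (h : gens P -> 'M[F]_n).
Hypothesis hP : forall x y, rels x y ->
  eval scalar_mx h x = eval scalar_mx h y.

Local Notation f := (Defs.lift scalar_mx h : palg P -> _).

Lemma rep_pi e : f (pi e) = eval scalar_mx h e.
Proof.
apply: lift_pi hP _ => //; first exact: raddfD.
  by move=> a b; rewrite -mulmxE mul_scalar_mx scale_scalar_mx.
by move=> c b; rewrite -!mulmxE scalar_mxC.
Qed.

Lemma rep_zmod : zmod_morphism f.
Proof.
elim/palg_ind=> x; elim/palg_ind=> y.
rewrite -scaleN1r scale_pi -piD !rep_pi /=.
by rewrite -mulmxE mul_scalar_mx scaleN1r.
Qed.

Lemma rep_monoid : monoid_morphism f.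
Proof.
split; first by rewrite -cst1 [LHS]rep_pi.
by elim/palg_ind=> x; elim/palg_ind=> y; rewrite -piM !rep_pi.
Qed.

HB.instance Definition _ :=
  GRing.isZmodMorphism.Build (palg P) 'M[F]_n f rep_zmod.
HB.instance Definition _ :=
  GRing.isMonoidMorphism.Build (palg P) 'M[F]_n f rep_monoid.

Lemma rep_scalable : scalable f.
Proof.
move=> c; elim/palg_ind=> x.
by rewrite scale_pi !rep_pi /= -mulmxE mul_scalar_mx.
Qed.

(** Every module constructed below arises in this way: matrices for the generators are given, and
    only the defining relations have to be checked. *)
Definition rep_mod : fdmod P := FdMod (mact := f) rep_scalable.

Lemma rep_modE i : mact rep_mod (gen i) = h i.
Proof. exact: rep_pi. Qed.
End Representation.

(** Reduces a claim about the action of an arbitrary element to an induction over expressions.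
    [mact_rels], [intertwine] and [submodule_gen] rest on it. *)
Lemma mact_pi (V : fdmod P) e :
  mact V (pi e) = eval scalar_mx (fun i => mact V (gen i)) e.
Proof.
elim: e => [i|c|x IHx y IHy|x IHx y IHy] //=.
- by rewrite pi_cst (mactZ V) rmorph1 -scalemx1.
- by rewrite piD rmorphD IHx IHy.
- by rewrite piM rmorphM IHx IHy.
Qed.

Lemma mact_rels (V : fdmod P) x y : rels x y ->
  eval scalar_mx (fun i => mact V (gen i)) x =
  eval scalar_mx (fun i => mact V (gen i)) y.
Proof. by move=> xy; rewrite -!mact_pi; congr (mact V _); apply/palgP/cong_rels. Qed.

Lemma intertwine (V W : fdmod P) (f : 'M_(mdim W, mdim V)) :
  (forall i, mact W (gen i) *m f = f *m mact V (gen i)) ->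
  forall a, mact W a *m f = f *m mact V a.
Proof.
move=> fG; elim/palg_ind=> e; rewrite !mact_pi.
elim: e => [i|c|x IHx y IHy|x IHx y IHy] //=.
- by rewrite mul_scalar_mx mul_mx_scalar.
- by rewrite mulmxDl mulmxDr IHx IHy.
- by rewrite -!mulmxE -mulmxA IHy !mulmxA IHx.
Qed.

Lemma submodule_gen (V : fdmod P) (U : {vspace 'cV[F]_(mdim V)}) :
  (forall i x, x \in U -> mact V (gen i) *m x \in U) -> submodule U.
Proof.
move=> UG; elim/palg_ind=> e; rewrite mact_pi.
elim: e => [i|c|x IHx y IHy|x IHx y IHy] v Uv /=; first exact: UG.
- by rewrite mul_scalar_mx memvZ.
- by rewrite mulmxDl memvD ?IHx ?IHy.
- by rewrite -mulmxE -mulmxA IHx ?IHy.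
Qed.
End PresentedAlgebra.

Section GeneratorMap.
Variables (F : fieldType) (P Q : presentation F) (g : gens P -> gens Q).
Hypothesis gP : forall x y, rels x y -> cong (emap g x) (emap g y).

Lemma eval_emap e :
  eval (@cst F Q) (fun i => gen (g i)) e = \pi_(palg Q) (emap g e).
Proof. by elim: e => //= x -> y ->; rewrite ?piD ?piM. Qed.

(** Serves [tin1], [tin2] and [Hincl], which all send generators to generators. *)
Lemma lift_emap e :
  Defs.lift (@cst F Q) (fun i : gens P => gen (g i)) (\pi_(palg P) e) =
  \pi_(palg Q) (emap g e).
Proof.
rewrite -eval_emap; apply: lift_pi.
- exact: cstD.
- exact: cstM.
- exact: cst1.
- exact: cst_comm.
- by move=> x y /gP xy; rewrite !eval_emap; apply/palgP.
Qed.
End GeneratorMap.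

(** * Kronecker products and the swap of two tensor factors *)

Section Kronecker.
Variable F : fieldType.

Lemma tensmxDl m n p q (A A' : 'M[F]_(m, n)) (B : 'M[F]_(p, q)) :
  (A + A') *t B = A *t B + A' *t B.
Proof. by apply/matrixP=> i j; rewrite !mxE mulrDl. Qed.

Lemma tensmxDr m n p q (A : 'M[F]_(m, n)) (B B' : 'M[F]_(p, q)) :
  A *t (B + B') = A *t B + A *t B'.
Proof. by apply/matrixP=> i j; rewrite !mxE mulrDr. Qed.

Lemma tensmxZl m n p q c (A : 'M[F]_(m, n)) (B : 'M[F]_(p, q)) :
  (c *: A) *t B = c *: (A *t B).
Proof. by apply/matrixP=> i j; rewrite !mxE mulrA. Qed.

Lemma tensmxZr m n p q c (A : 'M[F]_(m, n)) (B : 'M[F]_(p, q)) :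
  A *t (c *: B) = c *: (A *t B).
Proof. by apply/matrixP=> i j; rewrite !mxE mulrCA. Qed.

Lemma tensmxNl m n p q (A : 'M[F]_(m, n)) (B : 'M[F]_(p, q)) :
  (- A) *t B = - (A *t B).
Proof. by rewrite -scaleN1r tensmxZl scaleN1r. Qed.

Lemma tensmxNr m n p q (A : 'M[F]_(m, n)) (B : 'M[F]_(p, q)) :
  A *t (- B) = - (A *t B).
Proof. by rewrite -scaleN1r tensmxZr scaleN1r. Qed.

Lemma mxtens_index_eq n p (a c : 'I_n) (b d : 'I_p) :
  (mxtens_index (a, b) == mxtens_index (c, d)) = (a == c) && (b == d).
Proof. exact: (can_eq (@mxtens_indexK n p) (a, b) (c, d)). Qed.

Lemma tensmx11 n p : 1%:M *t 1%:M = 1%:M :> 'M[F]_(n * p).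
Proof.
apply/matrixP=> i j; case: (mxtens_indexP i) => i1 i2; case: (mxtens_indexP j) => j1 j2.
rewrite tensmxE !mxE (mxtens_index_eq i1 j1 i2 j2).
by rewrite -natrM mulnb.
Qed.

Lemma swap_mulmx n p k (M : 'M[F]_(n * p, k)) i j l :
  (swap_mx F n p *m M) (mxtens_index (i, j)) l = M (mxtens_index (j, i)) l.
Proof.
rewrite mxE (bigD1 (mxtens_index (j, i))) //= big1 ?addr0 => [|h].
  by rewrite !mxE !mxtens_indexK !eqxx mul1r.
case: (mxtens_indexP h) => a b; rewrite mxtens_index_eq.
rewrite !mxE !mxtens_indexK /= [i == b]eq_sym [j == a]eq_sym andbC.
by case: (_ && _) => //; rewrite mul0r.
Qed.

Lemma swap_tens n n' p p' (A : 'M[F]_(n', n)) (B : 'M[F]_(p', p)) :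
  swap_mx F n' p' *m (A *t B) = (B *t A) *m swap_mx F n p.
Proof.
apply/matrixP=> i j; case: (mxtens_indexP i) => a b; rewrite swap_mulmx.
case: (mxtens_indexP j) => c d; rewrite tensmxE mxE.
rewrite (bigD1 (mxtens_index (d, c))) //= big1 ?addr0 => [|h].
  by rewrite !mxE !mxtens_indexK !eqxx mulr1 /= mulrC.
case: (mxtens_indexP h) => a' b'; rewrite mxtens_index_eq.
rewrite !mxE !mxtens_indexK /= andbC.
by rewrite andbC; case: (_ && _) => //; rewrite mulr0.
Qed.
End Kronecker.

(** * Tensor products of modules and the braiding *)

Section TensorAction.
Variables (F : fieldType) (P : presentation F).

Section TensorModule.
Variables (V W : fdmod P).

Lemma eval_inl (n p : nat) (Q : presentation F) (f : gens P + gens Q -> 'M[F]_(n * p))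
    (h : gens P -> 'M[F]_n) e :
  (forall i, f (inl i) = h i *t 1%:M) ->
  eval (P := tens P Q) scalar_mx f (emap inl e) = eval scalar_mx h e *t 1%:M.
Proof.
move=> fh; elim: e => [i|c|x IHx y IHy|x IHx y IHy] //=.
- by rewrite -(scalemx1 n c) tensmxZl tensmx11 scalemx1.
- by rewrite IHx IHy tensmxDl.
- by rewrite IHx IHy -!mulmxE tensmx_mul mulmx1.
Qed.

Lemma eval_inr (n p : nat) (Q : presentation F) (f : gens Q + gens P -> 'M[F]_(n * p))
    (h : gens P -> 'M[F]_p) e :
  (forall i, f (inr i) = 1%:M *t h i) ->
  eval (P := tens Q P) scalar_mx f (emap inr e) = 1%:M *t eval scalar_mx h e.
Proof.
move=> fh; elim: e => [i|c|x IHx y IHy|x IHx y IHy] //=.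
- by rewrite -(scalemx1 p c) tensmxZr tensmx11 scalemx1.
- by rewrite IHx IHy tensmxDr.
- by rewrite IHx IHy -!mulmxE tensmx_mul mulmx1.
Qed.

Definition tens_gen (i : gens (tens P P)) : 'M[F]_(mdim V * mdim W) :=
  match i with
  | inl i => mact V (gen i) *t 1%:M
  | inr j => 1%:M *t mact W (gen j)
  end.

Lemma tens_act_rels x y : rels (p := tens P P) x y ->
  eval (P := tens P P) scalar_mx tens_gen x =
  eval (P := tens P P) scalar_mx tens_gen y.
Proof.
case=> [{}x {}y xy|{}x {}y xy|i j] /=.
- by rewrite !(@eval_inl _ _ _ _ (fun i => mact V (gen i))) // (mact_rels V xy).
- by rewrite !(@eval_inr _ _ _ _ (fun i => mact W (gen i))) // (mact_rels W xy).
- by rewrite -!mulmxE !tensmx_mul !mul1mx !mulmx1.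
Qed.

(** The action is [tens_act] up to conversion, whence [braidingE]. Packing it as a module makes it a
    ring morphism, to which [intertwine] applies. *)
Definition tens_mod : fdmod (tens P P) := rep_mod tens_act_rels.

Lemma tin1_pi e : tin1 P (\pi_(palg P) e) = \pi_(palg (tens P P)) (emap inl e).
Proof. by apply: lift_emap => x y xy; apply/cong_rels/tens_inl. Qed.

Lemma tin2_pi e : tin2 P (\pi_(palg P) e) = \pi_(palg (tens P P)) (emap inr e).
Proof. by apply: lift_emap => x y xy; apply/cong_rels/tens_inr. Qed.

Lemma tens_mod_tensor a b : mact tens_mod (a ⊗ b) = mact V a *t mact W b.
Proof.
rewrite /tensor rmorphM; elim/palg_ind: a => a; elim/palg_ind: b => b.
rewrite tin1_pi tin2_pi !mact_pi.
rewrite (@eval_inl _ _ _ _ (fun i => mact V (gen i))); last first.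
  by move=> i; rewrite rep_modE.
rewrite (@eval_inr _ _ _ _ (fun i => mact W (gen i))); last first.
  by move=> i; rewrite rep_modE.
by rewrite -mulmxE tensmx_mul mul1mx mulmx1.
Qed.
End TensorModule.

Lemma braidingE (Q : quasitriangular P) V W :
  braiding Q V W = swap_mx F (mdim V) (mdim W) *m mact (tens_mod V W) (Rmx Q).
Proof. by []. Qed.

(** On the generators of the first factor this is the hypothesis on [f]; those of the second act on
    the other side of the Kronecker product. *)
Lemma tens_mod_naturall (V V' W : fdmod P) (f : 'M_(mdim V', mdim V)) :
  (forall i, mact V' (gen i) *m f = f *m mact V (gen i)) ->
  forall a, mact (tens_mod V' W) a *m (f *t 1%:M) = (f *t 1%:M) *m mact (tens_mod V W) a.
Proof.
move=> fG.
apply: (@intertwine _ _ (tens_mod V W) (tens_mod V' W) (f *t 1%:M)) => -[] i;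
  rewrite !rep_modE /= !tensmx_mul.
  by rewrite fG !mulmx1.
by rewrite !mulmx1 !mul1mx.
Qed.

Lemma tens_mod_naturalr (V V' W : fdmod P) (f : 'M_(mdim V', mdim V)) :
  (forall i, mact V' (gen i) *m f = f *m mact V (gen i)) ->
  forall a, mact (tens_mod W V') a *m (1%:M *t f) = (1%:M *t f) *m mact (tens_mod W V) a.
Proof.
move=> fG.
apply: (@intertwine _ _ (tens_mod W V) (tens_mod W V') (1%:M *t f)) => -[] i;
  rewrite !rep_modE /= !tensmx_mul.
  by rewrite !mulmx1 !mul1mx.
by rewrite fG !mulmx1.
Qed.
End TensorAction.

(** * Semisimplicity in terms of equivariant projections *)

Section Semisimple.
Variables (F : fieldType) (P : presentation F) (V : fdmod P).
Local Notation vT := 'cV[F]_(mdim V).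
Implicit Types N U : {vspace vT}.

Definition invariant_projection N (f : 'End(vT)) : Prop :=
  [/\ forall a x, f (mact V a *m x) = mact V a *m f x,
      forall x, f x \in N & {in N, forall x, f x = x}].

Lemma submodule0 : submodule (0%VS : {vspace vT}).
Proof. by move=> a x; rewrite !memv0 => /eqP->; rewrite mulmx0. Qed.

Lemma submodule_cap N U : submodule N -> submodule U -> submodule (N :&: U)%VS.
Proof.
by move=> sN sU a x /memv_capP[xN xU]; apply/memv_capP; split; [apply: sN|apply: sU].
Qed.

Lemma submodule_add N U : submodule N -> submodule U -> submodule (N + U)%VS.
Proof.
move=> sN sU a _ /memv_addP[x xN [y yU ->]]; rewrite mulmxDr.
by apply: memv_add; [apply: sN|apply: sU].
Qed.

Lemma submodule_sum I (r : seq I) (Q : pred I) (U : I -> {vspace vT}) :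
  (forall i, submodule (U i)) -> submodule (\sum_(i <- r | Q i) U i)%VS.
Proof.
move=> sU; apply: (big_ind (@submodule F P V)) => //; first exact: submodule0.
exact: submodule_add.
Qed.

(** The projection along [C] is equivariant because the action preserves both components of [x] in
    [N + C]. *)
Lemma complement_projection N C :
  submodule N -> submodule C -> (N :&: C = 0)%VS -> (N + C = fullv)%VS ->
  exists f, invariant_projection N f.
Proof.
move=> sN sC dNC NC; exists (daddv_pi N C).
have dCN : (C :&: N = 0)%VS by rewrite capvC.
have piK x : daddv_pi N C x + daddv_pi C N x = x.
  by apply: daddv_pi_add; rewrite // NC memvf.
have pi0 x : x \in C -> daddv_pi N C x = 0.
  move=> xC; move: (piK x); rewrite (daddv_pi_id dCN xC).
  by rewrite -[X in _ = X]add0r => /addIr.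
split=> [a x|x|x xN]; last exact: daddv_pi_id; last exact: memv_pi.
rewrite -[in LHS](piK x) mulmxDr linearD /=.
rewrite (pi0 (mact V a *m daddv_pi C N x)) ?addr0; last exact/sC/memv_pi.
by apply: daddv_pi_id => //; apply: sN; apply: memv_pi.
Qed.

(** A complement of [N] is the sum over a maximal set [J] of simple summands such that this sum
    meets [N] trivially. By simplicity, each [U i] either lies in [N + \sum_(j in J) U j] or meets
    it trivially, and in the second case maximality puts [i] in [J]. *)
Lemma semisimple_projection N :
  semisimple V -> submodule N -> exists f, invariant_projection N f.
Proof.
case=> k [U [simpleU _ fullU]] sN.
have sU i : submodule (U i) by case: (simpleU i).
pose Q (J : {set 'I_k}) := (N :&: \sum_(i in J) U i)%VS == 0%VS.
have Q0 : Q set0 by rewrite /Q big_set0 capv0.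
case: (maxset_exists (P := Q) Q0) => J /maxsetP[/eqP QJ maxJ] _.
have sJ := @submodule_sum _ (index_enum 'I_k) (mem J) U sU.
apply: (complement_projection sN sJ QJ).
apply/eqP; rewrite eqEsubv subvf -fullU; apply/subv_sumP => i _.
case: (simpleU i) => _ _ /(_ (U i :&: (N + \sum_(i in J) U i))%VS) [].
- exact/submodule_cap/submodule_add.
- exact: capvSl.
- move=> Ui0; have iJ : i \in J.
    apply: contraT => iJ; suff QiJ : Q (i |: J).
      by rewrite -(maxJ _ QiJ (subsetUr _ _)) setU11 in iJ.
    (* Write [x = y + w] with [y] in [U i] and [w] in the sum over [J]. Then [y = x - w] lies in
       [U i] and in [N + \sum_(j in J) U j], so it vanishes, and [x = w] lies in the trivial
       intersection given by [QJ]. *)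
    rewrite /Q -subv0; apply/subvP => x /memv_capP[xN].
    rewrite big_setU1 //= => /memv_addP[y yU [w wJ xE]].
    have y0 : y = 0.
      apply/eqP; rewrite -memv0 -Ui0 memv_cap yU /=.
      have -> : y = x - w by rewrite xE addrK.
      by apply: memv_add; rewrite // memvN.
    have : x \in (N :&: \sum_(j in J) U j)%VS by rewrite memv_cap xN xE y0 add0r.
    by rewrite QJ.
  by apply: subv_trans (addvSr _ _); apply: (sumv_sup i).
- by move/capv_idPl.
Qed.

(** Induction on the dimension: either [N] has a proper nonzero submodule, to which the induction
    hypothesis applies, or it is simple itself. *)
Lemma simple_submodule_exists N :
  submodule N -> N != 0%VS -> exists2 S, simple_submodule S & (S <= N)%VS.
Proof.
have [k] := ubnP (\dim N); elim: k N => // k IHk N leNk sN N0.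
have [[W [sW WN W0 neWN]]|noW] := pselect (exists W,
    [/\ @submodule F P V W, (W <= N)%VS, W != 0%VS & W != N]).
  have [|S simS SW] := IHk W _ sW W0.
    rewrite -ltnS (leq_trans _ leNk) // ltnS ltnNge.
    by apply: contra neWN => leNW; rewrite eqEdim WN.
  by exists S => //; apply: subv_trans WN.
exists N => //; split=> // W sW WN.
have [->|W0] := eqVneq W 0%VS; first by left.
right; apply/eqP; apply: contrapT => /negP neWN; apply: noW; exists W.
by split.
Qed.

(** Splits off simple submodules one at a time: if [f] projects on a simple [S] in [N], then
    [x = f x + (x - f x)] gives [N = S + (N :&: lker f)], and the second summand has smaller
    dimension. The induction runs over the submodules of [V], so that only projections defined on
    [V] occur. *)
Lemma projection_semisimple :
  (forall N, submodule N -> exists f, invariant_projection N f) -> semisimple V.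
Proof.
move=> proj.
suff main N : submodule N -> exists k (U : 'I_k -> {vspace vT}),
    [/\ forall i, simple_submodule (U i),
        directv (\sum_i U i) & (\sum_i U i)%VS = N].
  by apply: main => a x _; apply: memvf.
have [k] := ubnP (\dim N); elim: k N => // k IHk N leNk sN.
have [->|N0] := eqVneq N 0%VS.
  exists 0, (fun=> 0%VS); rewrite directvE /= !big_ord0 dimv0.
  by split=> // -[].
have [S simS SN] := simple_submodule_exists sN N0.
have [sS S0 _] := simS.
have [f [fG fS fK]] := proj S sS.
have sC : submodule (N :&: lker f)%VS.
  apply: submodule_cap => // a x; rewrite !memv_ker fG => /eqP->.
  by rewrite mulmx0.
have dSC : (S :&: (N :&: lker f) = 0)%VS.
  apply/eqP; rewrite -subv0; apply/subvP=> x /memv_capP[xS /memv_capP[_]].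
  by rewrite memv_ker fK // memv0.
have SC : (S + (N :&: lker f) = N)%VS.
  apply/eqP; rewrite eqEsubv subv_add SN capvSl; apply/subvP=> x xN.
  rewrite -(subrKC (f x) x); apply: memv_add; first exact: fS.
  rewrite memv_cap memv_ker linearB /= (fK _ (fS x)) subrr eqxx andbT.
  by rewrite memvB // (subvP SN).
have ltC : (\dim (N :&: lker f) < k)%N.
  rewrite -ltnS (leq_trans _ leNk) // ltnS -{2}SC dimv_disjoint_sum //.
  by rewrite -[X in (X < _)%N]add0n ltn_add2r lt0n dimv_eq0.
have [l [U [simU dU sumU]]] := IHk _ ltC sC.
(* The index [ord0] stands for [S]; the others are those of [U], shifted by one. *)
exists l.+1, (fun i => oapp U S (unlift ord0 i)).
have UE : (\sum_i oapp U S (unlift ord0 i) = S + \sum_i U i)%VS.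
  rewrite big_ord_recl unlift_none; congr (_ + _)%VS.
  by apply: eq_bigr => i _; rewrite liftK.
split=> [i||]; last by rewrite UE sumU.
  by case: unliftP => [j|] _ //=.
move: dU; rewrite !directvE /= UE sumU dimv_disjoint_sum // => /eqP->.
rewrite big_ord_recl unlift_none /=; apply/eqP; congr (_ + _)%N.
by apply: eq_bigr => i _; rewrite liftK.
Qed.
End Semisimple.

(** * Modules over H as families of matrices, and the action of the R-matrix of H *)

Lemma eval_exp (F : fieldType) (P : presentation F) (B : pzRingType)
    (eta : F -> B) (h : gens P -> B) (e : expr F (gens P)) j :
  eta 1 = 1 -> eval eta h (e ^+ j)%X = eval eta h e ^+ j.
Proof. by move=> eta1; elim: j => //= j ->; rewrite exprS. Qed.

Section Nenciu.
Variable R : realType.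
Local Notation C := R[i].
Variables (s t : nat) (m : 'I_s -> nat) (d u : 'M[int]_(t, s)).
Local Notation nen := (nenciu R m d u).

(** Stating the relations of H for bare matrices allows a new module to be made from an old one by
    altering the matrices: by a sign, a twist or a doubling. *)
Record nenciu_mx (n : nat) (k : 'I_s -> 'M[C]_n) (x : 'I_t -> 'M[C]_n) : Prop := {
  nmx_order : forall a, k a ^+ m a = 1;
  nmx_KK : forall a b, k a * k b = k b * k a;
  nmx_KX : forall a j, k a * x j = xi_root R (m a) ^ d j a *: (x j * k a);
  nmx_X2 : forall j, x j * x j = 0;
  nmx_XX : forall j l,
    x l * x j = bxi R m (had (row j d) (row l u)) *: (x j * x l)
}.

Definition ngen_mx n (k : 'I_s -> 'M[C]_n) (x : 'I_t -> 'M[C]_n) (g : gens nen) :=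
  match g with nK a => k a | nX j => x j end.

Lemma ngen_mx_rels n k x (kx : @nenciu_mx n k x) y z : rels (p := nen) y z ->
  eval (P := nen) scalar_mx (ngen_mx k x) y =
  eval (P := nen) scalar_mx (ngen_mx k x) z.
Proof.
case=> [a|a b|a j|j|j l] //=.
- by rewrite (eval_exp (P := nen)) // (nmx_order kx).
- exact: nmx_KK kx _ _.
- by rewrite (nmx_KX kx) -!mulmxE mul_scalar_mx.
- by rewrite mulr1 (nmx_X2 kx) raddf0.
- by rewrite (nmx_XX kx) -!mulmxE mul_scalar_mx.
Qed.

Definition nmod n k x (kx : @nenciu_mx n k x) : fdmod nen :=
  rep_mod (ngen_mx_rels kx).

Definition actK (V : fdmod nen) a := mact V (HK R m d u a).
Definition actX (V : fdmod nen) j := mact V (HX R m d u j).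

Lemma nmod_actK n k x (kx : @nenciu_mx n k x) : actK (nmod kx) = k.
Proof. by apply/funext=> a; rewrite /actK rep_modE. Qed.

Lemma nmod_actX n k x (kx : @nenciu_mx n k x) : actX (nmod kx) = x.
Proof. by apply/funext=> j; rewrite /actX rep_modE. Qed.

Lemma nenciu_mx_act (V : fdmod nen) : nenciu_mx (actK V) (actX V).
Proof.
have relV := @mact_rels _ nen V; split=> [a|a b|a j|j|j l].
- have /= := relV _ _ (nrel_order R m d u a).
  by rewrite (eval_exp (P := nen)).
- exact: relV (nrel_KK R m d u a b).
- by have /= := relV _ _ (nrel_KX R m d u a j); rewrite -!mulmxE mul_scalar_mx.
- by have /= := relV _ _ (nrel_X2 R m d u j); rewrite mulr1 raddf0.
- by have /= := relV _ _ (nrel_XX R m d u j l); rewrite -!mulmxE mul_scalar_mx.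
Qed.

Lemma mact_Kpow (P : presentation C) (V : fdmod P) (K : 'I_s -> palg P) v :
  mact V (Kpow m K v) = Kpow m (fun a => mact V (K a)) v.
Proof. by rewrite rmorph_prod; apply: eq_bigr => a _; rewrite rmorphXn. Qed.

Variables (z : 'M[int]_s) (t2 : nat) (alpha : 'I_t2 -> C) (Zp Zm : 'I_t2 -> 'I_t).

Section RMatrix.
Variables (n p : nat) (k : 'I_s -> 'M[C]_n) (x : 'I_t -> 'M[C]_n).
Variables (k' : 'I_s -> 'M[C]_p) (x' : 'I_t -> 'M[C]_p).

Definition Rz_mx : 'M[C]_(n * p) :=
  (\prod_a (m a)%:R)^-1 *:
  \sum_(v : {dffun forall a : 'I_s, 'I_(m a)})
  \sum_(w : {dffun forall a : 'I_s, 'I_(m a)})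
    bxi R m (- had (zvec v) (zvec w)) *:
      (Kpow m k (zvec w) *t Kpow m k' (zvec v *m z)).

(** The exponent of [R_alpha] with [L] replaced by [K^{u_j}], where [j] indexes the generator in the
    first factor. In this form it depends only on the matrices of the [K_a] and [X_k], so it can be
    followed when these are altered. *)
Definition Zexponent : 'M[C]_(n * p) :=
  \sum_l alpha l *:
    (x (Zp l) *t (Kpow m k' (row (Zp l) u) * x' (Zm l)) -
     x (Zm l) *t (Kpow m k' (row (Zm l) u) * x' (Zp l))).

Definition nexp_mx (y : 'M[C]_(n * p)) : 'M[C]_(n * p) :=
  \sum_(j < (2 * t2).+1) (j`!%:R)^-1 *: y ^+ j.

Definition R_mx : 'M[C]_(n * p) :=
  Rz_mx * nexp_mx Zexponent.
End RMatrix.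

Lemma mact_Rz (P : presentation C) (V W : fdmod P) (K : 'I_s -> palg P) :
  mact (tens_mod V W) (Rz m K z) =
  Rz_mx (fun a => mact V (K a)) (fun a => mact W (K a)).
Proof.
rewrite /Rz (mactZ (tens_mod V W)) rmorph_sum; congr (_ *: _).
apply: eq_bigr => v _; rewrite rmorph_sum; apply: eq_bigr => w _.
by rewrite (mactZ (tens_mod V W)) tens_mod_tensor !mact_Kpow.
Qed.

Lemma mact_Ralpha (P : presentation C) (V W : fdmod P)
    (Yp Ym : 'I_t2 -> palg P) (L : palg P) :
  mact (tens_mod V W) (Ralpha alpha Yp Ym L) =
  nexp_mx (\sum_l alpha l *:
    (mact V (Yp l) *t (mact W L * mact W (Ym l)) -
     mact V (Ym l) *t (mact W L * mact W (Yp l)))).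
Proof.
rewrite /Ralpha /nexp rmorph_sum; apply: eq_bigr => j _.
rewrite (mactZ (tens_mod V W)) rmorphXn rmorph_sum; congr (_ *: _).
apply: (congr1 (fun y : 'M_(mdim V * mdim W) => y ^+ j)).
apply: eq_bigr => l _; rewrite (mactZ (tens_mod V W)) rmorphB.
by rewrite !tens_mod_tensor !rmorphM.
Qed.

Variables (L : palg nen) (H : quasitriangular nen).
Hypothesis hH : nenciu_ribbon H z Zp Zm L alpha.

(* The two formulas for the coproduct of a generator [X_j] of [Z]-type give
   [X_j ⊗ L = X_j ⊗ K^{u_j}], so [L] can be replaced by [K^{u_j}]. *)
Lemma tensmx_L (V W : fdmod nen) j (isZ : exists l, j = Zp l \/ j = Zm l) y :
  actX V j *t (mact W L * y) =
  actX V j *t (Kpow m (actK W) (row j u) * y).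
Proof.
have [[_ cX _ _] [_ _ _ _ cZ] _ _] := hH.
suff XL : actX V j *t mact W L = actX V j *t Kpow m (actK W) (row j u).
  rewrite -[actX V j]mulmx1 -!mulmxE -!tensmx_mul.
  by rewrite XL.
have := cX j; have -> : coprod H (HX R m d u j) =
    1 ⊗ HX R m d u j + HX R m d u j ⊗ L.
  by case: isZ => l [->|->]; [apply: (cZ (inl l))|apply: (cZ (inr l))].
move/addrI/(congr1 (mact (tens_mod V W))).
by rewrite !tens_mod_tensor mact_Kpow.
Qed.

(** The family [y] is arbitrary because it will be both the action of the [X_k] on [W] and that
    action multiplied by [K^{r''}]. *)
Lemma Zexponent_L (V W : fdmod nen) y :
  \sum_l alpha l *:
    (actX V (Zp l) *t (mact W L * y (Zm l)) -
     actX V (Zm l) *t (mact W L * y (Zp l))) =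
  Zexponent (actX V) (actK W) y.
Proof.
by apply: eq_bigr => l _; rewrite !tensmx_L //; exists l; [right|left].
Qed.

Lemma mact_Rmx (V W : fdmod nen) :
  mact (tens_mod V W) (Rmx H) = R_mx (actK V) (actX V) (actK W) (actX W).
Proof.
have [_ _ -> _] := hH.
by rewrite rmorphM mact_Rz mact_Ralpha (Zexponent_L V (actX W)).
Qed.
End Nenciu.

(** * Twisting and doubling of H-modules *)

Section Doubling.
Variable R : realType.
Local Notation C := R[i].
Variables (s t : nat) (m : 'I_s -> nat) (d u : 'M[int]_(t, s)).
Local Notation nen := (nenciu R m d u).

(** Every relation of H is homogeneous in the [X_k], so a central factor [c] comes out of both sides
    to the same power. Applied to [c = -1] and to [c = K^{r''}]. *)
Lemma nenciu_mx_twist n (c : 'M[C]_n) k x :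
  (forall a, GRing.comm c (k a)) -> (forall j, GRing.comm c (x j)) ->
  nenciu_mx m d u k x -> nenciu_mx m d u k (fun j => c * x j).
Proof.
move=> ck cx [kO kK kX x2 xX].
have cxcx j l : c * x j * (c * x l) = c * c * (x j * x l).
  by rewrite -!mulrA; congr (c * _); rewrite !mulrA -(cx j).
split=> // [a j|j|j l]; last 2 first.
- by rewrite cxcx x2 mulr0.
- by rewrite !cxcx xX -!mulmxE -scalemxAr.
rewrite mulrA -(ck a) -mulrA kX -!mulmxE -scalemxAr; congr (_ *: _).
by rewrite mulmxA.
Qed.

Lemma nenciu_mx_opp n (k : 'I_s -> 'M[C]_n) x :
  nenciu_mx m d u k x -> nenciu_mx m d u k (fun j => - x j).
Proof.
move=> kx; have -> : (fun j => - x j) = (fun j => - 1 * x j).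
  by apply/funext => j; rewrite mulN1r.
by apply: nenciu_mx_twist kx => ?; apply/commr_sym/commrN1.
Qed.

Definition dbl_even n (y : 'M[C]_n) : 'M[C]_(n + n) := block_mx y 0 0 y.
Definition dbl_odd n (y : 'M[C]_n) : 'M[C]_(n + n) := block_mx 0 y y 0.

Lemma dbl_evenM n (y w : 'M[C]_n) : dbl_even y * dbl_even w = dbl_even (y * w).
Proof. by rewrite -!mulmxE mulmx_block !mulmx0 !mul0mx !(addr0, add0r). Qed.

Lemma dbl_oddM n (y w : 'M[C]_n) : dbl_odd y * dbl_odd w = dbl_even (y * w).
Proof. by rewrite -!mulmxE mulmx_block !mulmx0 !mul0mx !(addr0, add0r). Qed.

Lemma dbl_evenodd n (y w : 'M[C]_n) : dbl_even y * dbl_odd w = dbl_odd (y * w).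
Proof. by rewrite -!mulmxE mulmx_block !mulmx0 !mul0mx !(addr0, add0r). Qed.

Lemma dbl_oddeven n (y w : 'M[C]_n) : dbl_odd y * dbl_even w = dbl_odd (y * w).
Proof. by rewrite -!mulmxE mulmx_block !mulmx0 !mul0mx !(addr0, add0r). Qed.

Lemma dbl_even1 n : dbl_even (1 : 'M[C]_n) = 1.
Proof. by rewrite /dbl_even -scalar_mx_block. Qed.

Lemma dbl_evenX n (y : 'M[C]_n) j : dbl_even y ^+ j = dbl_even (y ^+ j).
Proof. by elim: j => [|j IHj]; rewrite ?dbl_even1 // !exprS IHj dbl_evenM. Qed.

Lemma dbl_evenZ n c (y : 'M[C]_n) : c *: dbl_even y = dbl_even (c *: y).
Proof. by rewrite /dbl_even scale_block_mx !scaler0. Qed.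

Lemma dbl_oddZ n c (y : 'M[C]_n) : c *: dbl_odd y = dbl_odd (c *: y).
Proof. by rewrite /dbl_odd scale_block_mx !scaler0. Qed.

(** Doubled matrices are [y] times the identity or the exchange of the two copies, and the exchange
    squares to one. By homogeneity in the [X_k], both sides of a relation have the same parity. *)
Lemma nenciu_mx_dbl n (k : 'I_s -> 'M[C]_n) x : nenciu_mx m d u k x ->
  nenciu_mx m d u (fun a => dbl_even (k a)) (fun j => dbl_odd (x j)).
Proof.
case=> kO kK kX x2 xX; split=> [a|a b|a j|j|j l].
- by rewrite dbl_evenX kO dbl_even1.
- by rewrite !dbl_evenM kK.
- by rewrite dbl_evenodd dbl_oddeven dbl_oddZ kX.
- by rewrite dbl_oddM x2 /dbl_even block_mx0.
- by rewrite !dbl_oddM dbl_evenZ xX.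
Qed.

(** For [c = 1] and [c = -1] the image is the eigenspace for [c] of the exchange of the two copies.
    There an odd operator [dbl_odd y] acts as [c *: y]. *)
Definition dbl_in n (c : C) : 'M[C]_(n + n, n) := col_mx 1%:M c%:M.

Lemma dbl_even_in n (c : C) (y : 'M[C]_n) : dbl_even y *m dbl_in n c = dbl_in n c *m y.
Proof.
rewrite /dbl_even /dbl_in mul_block_col mul_col_mx !mul0mx addr0 add0r.
by rewrite mulmx1 mul1mx scalar_mxC.
Qed.

Lemma dbl_odd_in n (c : C) (y : 'M[C]_n) : c * c = 1 ->
  dbl_odd y *m dbl_in n c = dbl_in n c *m (c *: y).
Proof.
move=> cc; rewrite /dbl_odd /dbl_in mul_block_col mul_col_mx !mul0mx addr0 add0r.
by rewrite mulmx1 mul1mx mul_mx_scalar mul_scalar_mx scalerA cc scale1r.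
Qed.

(** The pair [(x, y)] is half the sum of [(x + y, x + y)] and [(x - y, y - x)]. Consequently an
    operator that fixes both inclusions is the identity, which is how [mueger_dbl] concludes. *)
Lemma dbl_in_full n : 2^-1 *: (dbl_in n 1 *m row_mx 1%:M 1%:M +
  dbl_in n (-1) *m row_mx 1%:M (- 1%:M)) = 1%:M.
Proof.
rewrite /dbl_in !mul_col_row !mul1mx raddfN !mulNmx mulmxN !mul1mx opprK.
rewrite add_block_mx !subrr scale_block_mx !scaler0 [RHS]scalar_mx_block.
have -> : 2^-1 *: (1%:M + 1%:M) = 1%:M :> 'M[C]_n; last by [].
by rewrite -mulr2n -[1%:M *+ 2]scaler_nat scalerA mulVf ?scale1r // pnatr_eq0.
Qed.

Variables (z : 'M[int]_s) (t2 : nat) (alpha : 'I_t2 -> C) (Zp Zm : 'I_t2 -> 'I_t).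
Variables (L : palg nen) (H : quasitriangular nen).
Hypothesis hH : nenciu_ribbon H z Zp Zm L alpha.

Lemma Zexponent_opp n p (k' : 'I_s -> 'M[C]_p) (x : 'I_t -> 'M[C]_n) x' :
  Zexponent m u alpha Zp Zm (fun j => - x j) k' x' =
  Zexponent m u alpha Zp Zm x k' (fun j => - x' j).
Proof.
by apply: eq_bigr => l _; rewrite !mulrN !tensmxNl !tensmxNr.
Qed.

(* The R-matrix only involves products [X_j ⊗ X_l], so a sign can be moved from
   one tensor factor to the other. *)
Lemma mueger_opp (V : fdmod nen) : mueger H V ->
  mueger H (nmod (nenciu_mx_opp (nenciu_mx_act V))).
Proof.
move=> mV W; have := mV (nmod (nenciu_mx_opp (nenciu_mx_act W))).
rewrite !braidingE !(mact_Rmx hH) !nmod_actK !nmod_actX.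
by rewrite /R_mx !Zexponent_opp.
Qed.

(** Both braidings are the action of an algebra element followed by a swap, so [f] moves through
    them and leaves the double braiding of [V] and [W], which is trivial. *)
Lemma double_braiding_natural (V V' : fdmod nen) (f : 'M_(mdim V', mdim V)) W :
  (forall i, mact V' (gen i) *m f = f *m mact V (gen i)) -> mueger H V ->
  braiding H W V' *m braiding H V' W *m (f *t 1%:M) = f *t 1%:M.
Proof.
move=> fG mV; rewrite !braidingE -!mulmxA (tens_mod_naturall W fG).
rewrite (mulmxA _ (f *t 1%:M)) swap_tens -!mulmxA.
rewrite (mulmxA _ (1%:M *t f)) (tens_mod_naturalr W fG) -!mulmxA.
rewrite (mulmxA _ (1%:M *t f)) swap_tens -!mulmxA.
by rewrite -[RHS]mulmx1 -(mV W) !braidingE -!mulmxA.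
Qed.

Lemma mueger_dbl (V : fdmod nen) : mueger H V ->
  mueger H (nmod (nenciu_mx_dbl (nenciu_mx_act V))).
Proof.
move=> mV W; set V2 := nmod _.
have natp : braiding H W V2 *m braiding H V2 W *m (dbl_in (mdim V) 1 *t 1%:M) =
    dbl_in (mdim V) 1 *t 1%:M.
  apply: (@double_braiding_natural V V2) mV => -[a|j]; rewrite rep_modE /=.
    exact: dbl_even_in.
  by rewrite dbl_odd_in ?mulr1 // scale1r.
have natm : braiding H W V2 *m braiding H V2 W *m (dbl_in (mdim V) (-1) *t 1%:M) =
    dbl_in (mdim V) (-1) *t 1%:M.
  apply: (@double_braiding_natural _ V2) (mueger_opp mV) => -[a|j].
    by rewrite !rep_modE /=; apply: dbl_even_in.
  by rewrite !rep_modE /= dbl_odd_in ?mulrNN ?mulr1 // scaleN1r.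
have splitE c (g : 'M[C]_(mdim V, mdim V + mdim V)) :
    (dbl_in (mdim V) c *m g) *t 1%:M =
    (dbl_in (mdim V) c *t 1%:M) *m (g *t 1%:M) :> 'M_(_ * mdim W, _ * mdim W).
  by rewrite tensmx_mul mulmx1.
move: (_ *m braiding H V2 W) natp natm => T natp natm.
rewrite -[T]mulmx1 -tensmx11 -(dbl_in_full (mdim V)).
by rewrite tensmxZl tensmxDl !splitE -scalemxAr mulmxDr !mulmxA natp natm.
Qed.
End Doubling.

Lemma eval_comp_emap (F : fieldType) (P Q : presentation F) (B : pzRingType)
    (eta : F -> B) (g : gens P -> gens Q) (h : gens Q -> B) e :
  eval eta h (emap g e) = eval (P := P) eta (fun i => h (g i)) e.
Proof. by elim: e => //= x -> y ->. Qed.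

(** * Sums of roots of unity and the Cartan factor D *)

Lemma root_of_unity_sum (F : fieldType) (w : F) n : w ^+ n = 1 ->
  \sum_(c < n) w ^+ c = if w == 1 then n%:R else 0.
Proof.
move=> wn; case: eqVneq => [->|w1].
  under eq_bigr => c _ do rewrite expr1n.
  by rewrite sumr_const card_ord.
apply: (mulfI (x := w - 1)); first by rewrite subr_eq0.
by rewrite -subrX1 wn subrr mulr0.
Qed.

Section Cartan.
Variables (F : fieldType) (q : F) (r : nat).
Hypotheses (hr : (8 %| r)%N) (hq : r.-primitive_root q).
Local Notation r' := (r %/ 2)%N.
Local Notation r'' := (r %/ 4)%N.

Lemma half_order : (r = 2 * r')%N.
Proof. by rewrite mulnC divnK // (dvdn_trans _ hr). Qed.

Lemma quarter_order : (r' = 2 * r'')%N.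
Proof.
have -> : (r'' = r' %/ 2)%N by rewrite -divnMA.
by rewrite mulnC divnK // dvdn_divRL ?(dvdn_trans _ hr).
Qed.

(** Divisibility of [r] by 8 enters here. [K] anticommutes with the [X_k], so its even power
    [K^{r''}] commutes with them. *)
Lemma odd_quarter_order : odd r'' = false.
Proof.
by apply/negbTE; rewrite -dvdn2 dvdn_divRL // ?(dvdn_trans _ hr).
Qed.

Lemma quarter_order_gt0 : (0 < r'')%N.
Proof.
by rewrite divn_gt0 // dvdn_leq // ?(prim_order_gt0 hq) // (dvdn_trans _ hr).
Qed.

Lemma half_order_gt0 : (0 < r')%N.
Proof. by rewrite quarter_order muln_gt0 quarter_order_gt0. Qed.

Lemma prim_root_half : q ^+ r' = -1.
Proof.
have /eqP : (q ^+ r') ^+ 2 = 1 by rewrite -exprM mulnC -half_order prim_expr_order.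
rewrite sqrf_eq1 => /orP[|/eqP//].
rewrite -(prim_order_dvd hq) => /dvdn_leq-/(_ half_order_gt0).
by rewrite {1}half_order leqNgt ltn_Pmull ?half_order_gt0.
Qed.

Lemma cartan_expr b c : q ^- (2 * b * c) = (q ^- (2 * b)) ^+ c.
Proof. by rewrite exprM exprVn. Qed.

Lemma cartan_root b : (q ^- (2 * b)) ^+ r' = 1.
Proof.
by rewrite exprVn -exprM mulnAC -half_order exprM (prim_expr_order hq) expr1n invr1.
Qed.

Lemma cartan_sum_even (b : 'I_r') :
  \sum_(c < r') q ^- (2 * b * c) = if b == 0%N :> nat then r'%:R else 0.
Proof.
under eq_bigr => c _ do rewrite cartan_expr.
rewrite root_of_unity_sum ?cartan_root // invr_eq1 -(prim_order_dvd hq).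
rewrite {1}half_order dvdn_pmul2l //; congr (if _ then _ else _).
case: b => -[//|b] /= ltb; rewrite ?dvdn0 //.
by apply/negbTE/negP => /dvdn_leq-/(_ isT); rewrite leqNgt ltb.
Qed.

(** The ratio [- q^(-2b)] of this geometric sum equals 1 exactly when [q^(2b) = -1 = q^r']. Since
    [2b] and [r'] are both less than [r], this means [2b = r' = 2r'']. *)
Lemma cartan_sum_odd (b : 'I_r') :
  \sum_(c < r') q ^- (2 * b * c) * (-1) ^+ c =
  if b == r'' :> nat then r'%:R else 0.
Proof.
under eq_bigr => c _ do rewrite cartan_expr -exprMn.
rewrite root_of_unity_sum; last first.
  by rewrite exprMn cartan_root mul1r quarter_order exprM sqrrN expr1n expr1n.
rewrite mulrN1 eqr_oppLR -(inj_eq invr_inj) invrK invrN invr1 -prim_root_half.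
have lt_b : (2 * b < r)%N by rewrite [ltnRHS]half_order ltn_pmul2l.
have lt_r' : (r' < r)%N by rewrite {2}half_order ltn_Pmull ?half_order_gt0.
rewrite (eq_prim_root_expr hq) !modn_small //.
congr (if _ then _ else _).
by rewrite [X in (_ == X) = _]quarter_order eqn_pmul2l.
Qed.

Section Action.
Variables (n p : nat).

Definition D_mx (A : 'M[F]_n) (B : 'M[F]_p) : 'M[F]_(n * p) :=
  (r'%:R)^-1 *: \sum_(b < r') \sum_(c < r')
    q ^- (2 * b * c) *: (A ^+ b *t B ^+ c).

Hypothesis r'_neq0 : r'%:R != 0 :> F.
Variables (e f : 'M[F]_p).
Hypotheses (ee : e * e = e) (ff : f * f = f) (ef : e * f = 0) (fe : f * e = 0).
Hypothesis e_f1 : e + f = 1.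

Lemma grading_expr c : (e - f) ^+ c = e + (-1) ^+ c *: f.
Proof.
elim: c => [|c IHc]; first by rewrite !expr0 scale1r e_f1.
rewrite exprS IHc mulrBl !mulrDr ee fe -!mulmxE -!scalemxAr !mulmxE ef ff.
by rewrite scaler0 addr0 add0r exprS mulN1r scaleNr.
Qed.

(** Here [e] and [f] project on the eigenspaces of [K] for 1 and -1 in the second factor. On each of
    them the sum over [c] is a character sum that leaves a single [b], namely 0 or [r'']. *)
Lemma D_mxE (A : 'M[F]_n) : D_mx A (e - f) = 1%:M *t e + A ^+ r'' *t f.
Proof.
rewrite /D_mx.
have -> : \sum_(b < r') \sum_(c < r')
    q ^- (2 * b * c) *: (A ^+ b *t (e - f) ^+ c) =
  \sum_(b < r') ((if b == 0%N :> nat then r'%:R else 0) *: (A ^+ b *t e) +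
    (if b == r'' :> nat then r'%:R else 0) *: (A ^+ b *t f)).
  apply: eq_bigr => b _; rewrite -cartan_sum_even -cartan_sum_odd !scaler_suml.
  rewrite -big_split; apply: eq_bigr => c _.
  by rewrite grading_expr tensmxDr tensmxZr scalerDr scalerA.
rewrite big_split /= (bigD1 (Ordinal half_order_gt0)) //= big1 ?addr0; last first.
  by move=> b; rewrite -val_eqE /= => /negPf->; rewrite scale0r.
have lt_r'' : (r'' < r')%N by rewrite quarter_order ltn_Pmull ?quarter_order_gt0.
rewrite (bigD1 (Ordinal lt_r'')) //= big1 ?addr0; last first.
  by move=> b; rewrite -val_eqE /= => /negPf->; rewrite scale0r.
by rewrite eqxx -scalerDr scalerA mulVf // scale1r expr0.
Qed.
End Action.

(** The coefficient [q^(-2bc)] is symmetric in [b] and [c]. *)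
Lemma swap_D_mx n p (A : 'M[F]_n) (B : 'M[F]_p) :
  swap_mx F n p *m D_mx A B = D_mx B A *m swap_mx F n p.
Proof.
rewrite /D_mx -scalemxAr -scalemxAl mulmx_sumr mulmx_suml; congr (_ *: _).
under eq_bigr => b _ do rewrite mulmx_sumr.
rewrite exchange_big; apply: eq_bigr => b _ /=.
rewrite mulmx_suml; apply: eq_bigr => c _.
by rewrite -scalemxAr -scalemxAl swap_tens mulnAC.
Qed.
End Cartan.

(** * Restriction from U ⋉ H to H and the R-matrix of U ⋉ H *)

Section Biproduct.
Variables (R : realType) (r : nat) (q : R[i]).
Hypotheses (hr : (8 %| r)%N) (hq : r.-primitive_root q).
Local Notation C := R[i].
Local Notation r' := (r %/ 2)%N.
Local Notation r'' := (r %/ 4)%N.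
Variables (s t : nat) (m : 'I_s -> nat) (d u : 'M[int]_(t, s)).
Local Notation nen := (nenciu R m d u).
Local Notation bip := (biproduct m d u q r).
Local Notation bgenH g := (gen (bH g : gens bip)).

Section Restriction.
Variable W : fdmod bip.

Lemma Hrestrict_rels y w : rels (p := nen) y w ->
  eval (P := nen) scalar_mx (fun g => mact W (bgenH g)) y =
  eval (P := nen) scalar_mx (fun g => mact W (bgenH g)) w.
Proof.
move=> yw.
rewrite -!(eval_comp_emap (P := nen) (Q := bip) _ (@bH s t) (fun g => mact W (gen g))).
exact/mact_rels/brel_H.
Qed.

Definition Hrestrict : fdmod nen := rep_mod Hrestrict_rels.

Lemma mact_Hincl a : mact W (Hincl q r a) = mact Hrestrict a.
Proof.
elim/palg_ind: a => e; rewrite /Hincl (lift_emap (P := nen) (Q := bip)); last first.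
  by move=> y w yw; apply/cong_rels/brel_H.
rewrite !mact_pi (eval_comp_emap (P := nen) (Q := bip)).
by elim: e => //= [g|y -> w ->|y -> w ->] //; apply/esym/(rep_modE Hrestrict_rels).
Qed.

Definition actU := mact W (UK m d u q r) ^+ r''.

Lemma actK_comm a : GRing.comm (mact W (UK m d u q r)) (actK Hrestrict a).
Proof.
rewrite /actK rep_modE; apply/esym.
exact: (mact_rels W (brel_KaK m d u q r a)).
Qed.

Lemma actX_anticomm j :
  mact W (UK m d u q r) * actX Hrestrict j = - (actX Hrestrict j * mact W (UK m d u q r)).
Proof.
rewrite /actX rep_modE.
have /= := mact_rels W (brel_KX m d u q r j).
by rewrite -!mulmxE mul_scalar_mx scaleN1r.
Qed.

Lemma actU_commK a : GRing.comm actU (actK Hrestrict a).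
Proof. exact/commr_sym/commrX/commr_sym/actK_comm. Qed.

Lemma actU_commX j : GRing.comm actU (actX Hrestrict j).
Proof.
have -> : actU = (mact W (UK m d u q r) ^+ 2) ^+ r''./2.
  rewrite /actU -exprM mul2n -[in LHS](odd_double_half r'').
  by rewrite (odd_quarter_order hr).
apply/commr_sym/commrX; rewrite /GRing.comm expr2 -mulrA (actX_anticomm j).
by rewrite mulrN [in RHS]mulrA actX_anticomm mulNr opprK mulrA.
Qed.

Lemma actU_sqr : actU * actU = 1.
Proof.
rewrite -exprD addnn -mul2n -(quarter_order hr).
have /= := mact_rels W (brel_K m d u q r).
by rewrite (eval_exp (P := bip)).
Qed.

(** The module [W^tw]. *)
Definition twist : fdmod nen :=
  nmod (nenciu_mx_twist actU_commK actU_commX (nenciu_mx_act Hrestrict)).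

Lemma twist_actK : actK twist = actK Hrestrict.
Proof. exact: nmod_actK. Qed.

Lemma twist_actX : actX twist = fun j => actU * actX Hrestrict j.
Proof. exact: nmod_actX. Qed.

Lemma mact_UHK : (fun a => mact W (UHK m d u q r a)) = actK Hrestrict.
Proof. by apply/funext=> a; rewrite mact_Hincl. Qed.

Lemma mact_UHX j : mact W (UHX m d u q r j) = actX Hrestrict j.
Proof. exact: mact_Hincl. Qed.

(** Needed for [a = L], which is not given as a word in the generators. *)
Lemma actU_comm_mact a : actU * mact Hrestrict a = mact Hrestrict a * actU.
Proof.
apply/esym; apply: (@intertwine _ _ Hrestrict Hrestrict actU) => -[b|j].
  exact/esym/actU_commK.
exact/esym/actU_commX.
Qed.
End Restriction.

Variables (z : 'M[int]_s) (t2 : nat) (alpha : 'I_t2 -> C) (Zp Zm : 'I_t2 -> 'I_t).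
Variables (L : palg nen) (H : quasitriangular nen) (UH : quasitriangular bip).
Hypotheses (hH : nenciu_ribbon H z Zp Zm L alpha).
Hypotheses (hUH : biproduct_quasitriangular UH z Zp Zm L alpha).

Lemma mact_Dmx (V W : fdmod bip) : mact (tens_mod V W) (Dmx m d u q r) =
  D_mx q r (mact V (UK m d u q r)) (mact W (UK m d u q r)).
Proof.
rewrite /Dmx (mactZ (tens_mod V W)) rmorph_sum; congr (_ *: _).
apply: eq_bigr => b _; rewrite rmorph_sum; apply: eq_bigr => c _.
by rewrite (mactZ (tens_mod V W)) tens_mod_tensor !rmorphXn.
Qed.

Lemma mact_Theta (V W : fdmod bip) :
  mact V (UE m d u q r) = 0 \/ mact W (UF m d u q r) = 0 ->
  mact (tens_mod V W) (Theta m d u q r) = 1.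
Proof.
move=> EF0; rewrite /Theta rmorph_sum.
rewrite (bigD1 (Ordinal (half_order_gt0 hr hq))) //= big1 ?addr0 => [|a].
  rewrite (mactZ (tens_mod V W)) tens_mod_tensor !rmorphXn !expr0.
  by rewrite /qfact big_geq // divr1 mulr1 scale1r tensmx11.
rewrite -val_eqE /= => a0; rewrite (mactZ (tens_mod V W)) tens_mod_tensor !rmorphXn.
by case: EF0 => ->; rewrite expr0n (negPf a0) ?tens0mx ?tensmx0 scaler0.
Qed.

(** The factor [Theta] reduces to its term of index 0. The [K^{r''}] in [K^{r''} L] commutes with
    the action of [L] and is absorbed by the [X_k] of the second factor, which turns [W] into
    [W^tw]. *)
Lemma mact_biproduct_Rmx (V W : fdmod bip) :
  mact V (UE m d u q r) = 0 \/ mact W (UF m d u q r) = 0 ->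
  mact (tens_mod V W) (Rmx UH) =
  D_mx q r (mact V (UK m d u q r)) (mact W (UK m d u q r)) *
  R_mx m u z alpha Zp Zm (actK (Hrestrict V)) (actX (Hrestrict V))
    (actK (twist W)) (actX (twist W)).
Proof.
move=> EF0; have [_ ->] := hUH.
have expE : \sum_l alpha l *:
    (mact V (UHX m d u q r (Zp l)) *t (mact W (UK m d u q r ^+ r'' * Hincl q r L) *
       mact W (UHX m d u q r (Zm l))) -
     mact V (UHX m d u q r (Zm l)) *t (mact W (UK m d u q r ^+ r'' * Hincl q r L) *
       mact W (UHX m d u q r (Zp l)))) =
    Zexponent m u alpha Zp Zm (actX (Hrestrict V)) (actK (twist W)) (actX (twist W)).
  rewrite twist_actK -(Zexponent_L hH (Hrestrict V) (W := Hrestrict W)).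
  apply: eq_bigr => l _; rewrite !mact_UHX rmorphM rmorphXn mact_Hincl -/(actU W).
  by rewrite actU_comm_mact -!mulrA twist_actX.
rewrite !rmorphM mact_Dmx (mact_Theta EF0) mulr1 mact_Rz mact_Ralpha !mact_UHK.
rewrite [X in nexp_mx _ X]expE.
by clear expE; rewrite /R_mx twist_actK mulrA.
Qed.
End Biproduct.

(** * The U ⋉ H-module V' and its double braidings *)

Lemma pair_vspace (F : fieldType) n (N : {vspace 'cV[F]_n}) :
  exists N2 : {vspace 'cV[F]_(n + n)},
    forall x y, (col_mx x y \in N2) = (x \in N) && (y \in N).
Proof.
pose up : 'Hom('cV[F]_(n + n), 'cV[F]_n) := linfun (mulmx (row_mx 1%:M 0)).
pose dn : 'Hom('cV[F]_(n + n), 'cV[F]_n) := linfun (mulmx (row_mx 0 1%:M)).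
have upE x y : up (col_mx x y) = x.
  by rewrite lfunE /= mul_row_col mul1mx mul0mx addr0.
have dnE x y : dn (col_mx x y) = y.
  by rewrite lfunE /= mul_row_col mul1mx mul0mx add0r.
exists (up @^-1: N :&: dn @^-1: N)%VS => x y.
by rewrite memv_cap -!memv_preim upE dnE.
Qed.

Section Induced.
Variables (R : realType) (r : nat) (q : R[i]).
Hypotheses (hr : (8 %| r)%N) (hq : r.-primitive_root q).
Local Notation C := R[i].
Local Notation r' := (r %/ 2)%N.
Local Notation r'' := (r %/ 4)%N.
Variables (s t : nat) (m : 'I_s -> nat) (d u : 'M[int]_(t, s)).
Local Notation nen := (nenciu R m d u).
Local Notation bip := (biproduct m d u q r).

(** The projections [p_+] and [p_-]; their difference [dbl_sgn] is the action of [K] on [V']. *)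
Definition dbl_up n : 'M[C]_(n + n) := block_mx 1%:M 0 0 0.
Definition dbl_dn n : 'M[C]_(n + n) := block_mx 0 0 0 1%:M.
Definition dbl_sgn n : 'M[C]_(n + n) := dbl_up n - dbl_dn n.

Lemma dbl_up_id n : dbl_up n * dbl_up n = dbl_up n.
Proof. by rewrite -mulmxE mulmx_block !(mulmx0, mul0mx) !addr0 mulmx1. Qed.
Lemma dbl_dn_id n : dbl_dn n * dbl_dn n = dbl_dn n.
Proof. by rewrite -mulmxE mulmx_block !(mulmx0, mul0mx) !add0r mulmx1. Qed.
Lemma dbl_up_dn n : dbl_up n * dbl_dn n = 0.
Proof. by rewrite -mulmxE mulmx_block !(mulmx0, mul0mx) !addr0 block_mx0. Qed.
Lemma dbl_dn_up n : dbl_dn n * dbl_up n = 0.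
Proof. by rewrite -mulmxE mulmx_block !(mulmx0, mul0mx) !addr0 block_mx0. Qed.
Lemma dbl_up_add_dn n : dbl_up n + dbl_dn n = 1.
Proof. by rewrite add_block_mx !(addr0, add0r) -scalar_mx_block. Qed.

Lemma dbl_up_even n (y : 'M[C]_n) : GRing.comm (dbl_up n) (dbl_even y).
Proof.
by rewrite /GRing.comm -!mulmxE !mulmx_block !(mulmx0, mul0mx) !addr0 mulmx1 mul1mx.
Qed.
Lemma dbl_dn_even n (y : 'M[C]_n) : GRing.comm (dbl_dn n) (dbl_even y).
Proof.
by rewrite /GRing.comm -!mulmxE !mulmx_block !(mulmx0, mul0mx) !add0r mulmx1 mul1mx.
Qed.
Lemma dbl_up_odd n (y : 'M[C]_n) : dbl_up n * dbl_odd y = dbl_odd y * dbl_dn n.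
Proof.
by rewrite -!mulmxE !mulmx_block !(mulmx0, mul0mx) !(addr0, add0r) mulmx1 mul1mx.
Qed.
Lemma dbl_dn_odd n (y : 'M[C]_n) : dbl_dn n * dbl_odd y = dbl_odd y * dbl_up n.
Proof.
by rewrite -!mulmxE !mulmx_block !(mulmx0, mul0mx) !(addr0, add0r) mulmx1 mul1mx.
Qed.

Lemma dbl_sgn_sqr n : dbl_sgn n ^+ 2 = 1.
Proof.
rewrite (grading_expr (dbl_up_id n) (dbl_dn_id n) (dbl_up_dn n) (dbl_dn_up n)).
  by rewrite sqrrN expr1n scale1r dbl_up_add_dn.
exact: dbl_up_add_dn.
Qed.

Lemma dbl_sgn_half n : dbl_sgn n ^+ r' = 1.
Proof. by rewrite (quarter_order hr) exprM dbl_sgn_sqr expr1n. Qed.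

Section GradedCartan.
Variables (n p : nat) (c : 'M[C]_p).
Hypothesis cc : c * c = 1.

(** The action of D on [W ⊗ V'] when [c] is the action of [K^{r''}] on [W]; see [D_mx_induced]. *)
Definition D_act : 'M[C]_(p * (n + n)) :=
  1%:M *t dbl_up n + c *t dbl_dn n.

Lemma D_act_sqr : D_act * D_act = 1.
Proof.
rewrite mulrDl !mulrDr -!mulmxE !tensmx_mul !mulmxE !mul1r mulr1.
rewrite dbl_up_id dbl_dn_id dbl_up_dn dbl_dn_up !tensmx0 addr0 add0r.
by rewrite cc -tensmxDr dbl_up_add_dn tensmx11.
Qed.

Lemma D_act_even (y : 'M[C]_p) (w : 'M[C]_n) : GRing.comm c y ->
  GRing.comm D_act (y *t dbl_even w).
Proof.
move=> cy; rewrite /GRing.comm mulrDl mulrDr -!mulmxE !tensmx_mul !mulmxE.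
by rewrite mul1r mulr1 dbl_up_even dbl_dn_even cy.
Qed.

(** An odd operator exchanges the two copies, so exactly one of the two outer factors contributes a
    [c]. *)
Lemma D_act_odd (y : 'M[C]_p) (w : 'M[C]_n) : GRing.comm c y ->
  D_act * (y *t dbl_odd w) * D_act = (c * y) *t dbl_odd w.
Proof.
move=> cy; rewrite /D_act -!mulmxE mulmxDl !tensmx_mul mul1mx !mulmxE.
rewrite (dbl_up_odd w) (dbl_dn_odd w) -!mulmxE mulmxDl !mulmxDr.
rewrite !tensmx_mul !mulmx1 !mulmxE.
rewrite -!(mulrA (dbl_odd w)) dbl_up_id dbl_dn_id dbl_up_dn dbl_dn_up.
rewrite mulr0 !tensmx0 addr0 add0r -cy.
by rewrite addrC -tensmxDr -mulrDr dbl_up_add_dn mulr1.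
Qed.

Lemma D_act_conj (y w : 'M[C]_(p * (n + n))) :
  D_act * y * D_act = w -> forall j, D_act * y ^+ j * D_act = w ^+ j.
Proof.
move=> <-; elim=> [|j IHj]; first by rewrite !expr0 mulr1 D_act_sqr.
rewrite [in RHS]exprS -IHj exprS !mulrA; congr (_ * _ * _).
by rewrite -[in RHS](mulrA _ D_act D_act) D_act_sqr mulr1.
Qed.

End GradedCartan.

Lemma Kpow_comm (A : pzRingType) (y : A) (k : 'I_s -> A) v :
  (forall a, GRing.comm y (k a)) -> GRing.comm y (Kpow m k v).
Proof. by move=> ck; apply: commr_prod => a _; apply: commrX. Qed.

Lemma Kpow_dbl_even n (k : 'I_s -> 'M[C]_n) v :
  Kpow m (fun a => dbl_even (k a)) v = dbl_even (Kpow m k v).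
Proof.
rewrite /Kpow; under eq_bigr => a _ do rewrite dbl_evenX.
by apply/esym/big_morph; [move=> ? ?; rewrite dbl_evenM|exact: dbl_even1].
Qed.

Variables (z : 'M[int]_s) (t2 : nat) (alpha : 'I_t2 -> C) (Zp Zm : 'I_t2 -> 'I_t).

(** [R_z] is even in the second factor and commutes with D. Each term of the exponent is odd there,
    so conjugation by the involution D multiplies its first factor by [c]; being multiplicative,
    conjugation then passes through the powers. *)
Lemma D_act_R_mx n p (c : 'M[C]_p) (k : 'I_s -> 'M[C]_p) (x : 'I_t -> 'M[C]_p)
    (k' : 'I_s -> 'M[C]_n) (x' : 'I_t -> 'M[C]_n) :
  c * c = 1 -> (forall a, GRing.comm c (k a)) -> (forall j, GRing.comm c (x j)) ->
  D_act n c * R_mx m u z alpha Zp Zm k x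
    (fun a => dbl_even (k' a)) (fun j => dbl_odd (x' j)) * D_act n c =
  R_mx m u z alpha Zp Zm k (fun j => c * x j)
    (fun a => dbl_even (k' a)) (fun j => dbl_odd (x' j)).
Proof.
move=> cc ck cx; rewrite /R_mx; set rz := Rz_mx _ _ _ _.
have DRz : GRing.comm (D_act n c) rz.
  rewrite /rz /Rz_mx; set b := (_ ^-1); rewrite /GRing.comm -!mulmxE.
  rewrite -scalemxAr -scalemxAl !mulmxE; congr (_ *: _).
  apply: commr_sum => v _; apply: commr_sum => w _; rewrite /GRing.comm -!mulmxE.
  rewrite -scalemxAr -scalemxAl !mulmxE; congr (_ *: _).
  by rewrite Kpow_dbl_even; apply/D_act_even/Kpow_comm.
rewrite mulrA DRz -!mulrA; congr (_ * _); rewrite mulrA.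
rewrite /nexp_mx mulr_sumr mulr_suml; apply: eq_bigr => j _.
rewrite -!mulmxE -scalemxAr -scalemxAl !mulmxE; congr (_ *: _).
apply: D_act_conj => //.
rewrite /Zexponent mulr_sumr mulr_suml; apply: eq_bigr => l _.
rewrite -!mulmxE -scalemxAr -scalemxAl !mulmxE; congr (_ *: _).
rewrite mulrBr mulrBl !Kpow_dbl_even !dbl_evenodd.
by congr (_ - _); apply: D_act_odd.
Qed.

Variable V : fdmod nen.
Local Notation n := (mdim V).

Definition induced_gen (g : gens bip) : 'M[C]_(n + n) :=
  match g with
  | bK => dbl_sgn n
  | bE => 0
  | bF => 0
  | bH g => ngen_mx (fun a => dbl_even (actK V a)) (fun j => dbl_odd (actX V j))
      (g : gens nen)
  end.

(** [K] acts by an involution, hence equals its inverse, written [K^{r'-1}]. This makes the relation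
    for [[E,F]] hold with [E = F = 0]. The [X_k] exchange the eigenspaces of [K], hence anticommute
    with it. *)
Lemma induced_rels y w : rels (p := bip) y w ->
  eval (P := bip) scalar_mx induced_gen y = eval (P := bip) scalar_mx induced_gen w.
Proof.
have r'_gt0 := half_order_gt0 hr hq.
have sgnX : dbl_sgn n ^+ (r' - 1) = dbl_sgn n.
  rewrite -[RHS]mulr1 -(dbl_sgn_half n) -{2}(subnK r'_gt0) addn1 exprS mulrA.
  by rewrite -expr2 dbl_sgn_sqr mul1r.
case=> /= [||||||{}y {}w yw|a|a|a|j|j|j].
- by rewrite (eval_exp (P := bip)) //= dbl_sgn_half.
- by rewrite (eval_exp (P := bip)) //= expr0n eqn0Ngt r'_gt0 -scalemx1 scale0r.
- by rewrite (eval_exp (P := bip)) //= expr0n eqn0Ngt r'_gt0 -scalemx1 scale0r.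
- by rewrite !(mulr0, mul0r).
- by rewrite !(mulr0, mul0r).
- rewrite (eval_exp (P := bip)) //= sgnX !mulr0 addr0.
  by rewrite -!mulmxE !mul_scalar_mx scaleN1r subrr scaler0.
- rewrite !(eval_comp_emap (P := nen) (Q := bip)).
  exact: (ngen_mx_rels (nenciu_mx_dbl (nenciu_mx_act V)) yw).
- by rewrite mulrBr mulrBl dbl_up_even dbl_dn_even.
- by rewrite !(mulr0, mul0r).
- by rewrite !(mulr0, mul0r).
- rewrite -!mulmxE mul_scalar_mx scaleN1r !mulmxE mulrBr mulrBl.
  by rewrite dbl_up_odd dbl_dn_odd opprB.
- by rewrite !(mulr0, mul0r).
- by rewrite !(mulr0, mul0r).
Qed.

Definition induced : fdmod bip := rep_mod induced_rels.

Lemma induced_UK : mact induced (UK m d u q r) = dbl_sgn n.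
Proof. exact: (rep_modE induced_rels). Qed.
Lemma induced_UE : mact induced (UE m d u q r) = 0.
Proof. exact: (rep_modE induced_rels). Qed.
Lemma induced_UF : mact induced (UF m d u q r) = 0.
Proof. exact: (rep_modE induced_rels). Qed.

Lemma induced_K : actK (Hrestrict induced) = fun a => dbl_even (actK V a).
Proof. by apply/funext=> a; rewrite /actK !rep_modE. Qed.

Lemma induced_X : actX (Hrestrict induced) = fun j => dbl_odd (actX V j).
Proof. by apply/funext=> a; rewrite /actX !rep_modE. Qed.

(** As [r''] is even, [K^{r''}] acts on [V'] by 1, so the twist does not change [V']. *)
Lemma induced_twistX : actX (twist hr induced) = fun j => dbl_odd (actX V j).
Proof.
rewrite twist_actX induced_X; apply/funext=> j.
rewrite /actU induced_UK -[r''](odd_double_half) (odd_quarter_order hr) add0n.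
by rewrite -mul2n exprM dbl_sgn_sqr expr1n mul1r.
Qed.

Lemma induced_semisimple : semisimple induced -> semisimple V.
Proof.
move=> ssV'; apply: projection_semisimple => N sN.
(* [N2] is [N ⊕ N]. It is stable because the blocks by which the generators act on [V'] are zero,
   signs, or actions of elements of H on [V]. *)
have [N2 N2E] := pair_vspace N.
have sN2 : @submodule _ _ induced N2.
  apply: submodule_gen => g x; rewrite -[x]vsubmxK N2E => /andP[xN yN].
  rewrite rep_modE; case: g => [|||[a|j]] /=; last 2 first.
  - by rewrite mul_block_col !mul0mx addr0 add0r N2E !sN.
  - by rewrite mul_block_col !mul0mx addr0 add0r N2E !sN.
  - rewrite /dbl_sgn /dbl_up /dbl_dn opp_block_mx add_block_mx !oppr0 !addr0.
    rewrite mul_block_col !mul0mx add0r.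
    by rewrite addr0 add0r mulNmx !mul1mx N2E xN memvN.
  - by rewrite mul0mx mem0v.
  - by rewrite mul0mx mem0v.
have [f [fG fN fK]] := semisimple_projection ssV' sN2.
(* The diagonal [x |-> (x, x)] and its left inverse, the mean of the two components. Both commute
   with H, since [X_k] sends [(x, y)] to [(X_k y, X_k x)]; the required projection is [f] between
   them. *)
pose inj : 'Hom('cV[C]_n, 'cV[C]_(n + n)) := linfun (mulmx (dbl_in n 1)).
pose prj : 'Hom('cV[C]_(n + n), 'cV[C]_n) :=
  linfun (mulmx (2^-1 *: row_mx 1%:M 1%:M)).
have injE x : inj x = col_mx x x by rewrite lfunE /= mul_col_mx !mul1mx.
have prjE x y : prj (col_mx x y) = 2^-1 *: (x + y).
  by rewrite lfunE /= -scalemxAl mul_row_col !mul1mx.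
have injG a x : inj (mact V a *m x) = mact (Hrestrict induced) a *m inj x.
  rewrite !lfunE /= !mulmxA; congr (_ *m _); apply/esym.
  apply: (@intertwine _ _ V (Hrestrict induced)) => -[b|j]; rewrite !rep_modE /=.
    exact: dbl_even_in.
  by rewrite dbl_odd_in ?mulr1 // scale1r.
have prjG a x : prj (mact (Hrestrict induced) a *m x) = mact V a *m prj x.
  rewrite !lfunE /= !mulmxA; congr (_ *m _); apply/esym.
  apply: (@intertwine _ _ (Hrestrict induced) V) => g; rewrite -scalemxAl -scalemxAr.
  congr (_ *: _); case: g => [b|j]; rewrite !rep_modE /=;
    by rewrite mul_row_block mul_mx_row !mul1mx !mulmx1 !(addr0, add0r).
exists (prj \o f \o inj)%VF; split=> [a x|x|x xN].
- by rewrite !comp_lfunE injG -mact_Hincl fG mact_Hincl prjG.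
- rewrite !comp_lfunE; have := fN (inj x).
  by rewrite -[f _]vsubmxK N2E prjE => /andP[? ?]; rewrite memvZ ?memvD.
- have xN2 : inj x \in N2 by rewrite injE N2E xN.
  rewrite !comp_lfunE (fK _ xN2) injE prjE -mulr2n -[x *+ 2]scaler_nat scalerA.
  by rewrite mulVf ?scale1r // pnatr_eq0.
Qed.

Variables (L : palg nen) (H : quasitriangular nen) (UH : quasitriangular bip).
Hypotheses (hH : nenciu_ribbon H z Zp Zm L alpha).
Hypotheses (hUH : biproduct_quasitriangular UH z Zp Zm L alpha).

Section Braiding.
Variable W : fdmod bip.
Local Notation p := (mdim W).

Lemma D_mx_induced : D_mx q r (mact W (UK m d u q r)) (dbl_sgn n) = D_act n (actU W).
Proof.
apply: (D_mxE hr hq); rewrite ?dbl_up_id ?dbl_dn_id ?dbl_up_dn ?dbl_dn_up //.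
  by rewrite pnatr_eq0 -lt0n (half_order_gt0 hr hq).
exact: dbl_up_add_dn.
Qed.

(** Each braiding contributes one D. Moved through the swap, the D on [V' ⊗ W] becomes that on
    [W ⊗ V'], and the two together conjugate the R-matrix of [W] and [V'] into that of [W^tw] and
    [V']. *)
Lemma braiding_induced : mueger H V ->
  braiding UH W induced *m braiding UH induced W = 1%:M.
Proof.
(* [Theta] acts trivially for both orders of the factors: [F] vanishes on [V'] as second factor, [E]
   on [V'] as first. *)
have RWV := mact_biproduct_Rmx hr hq hH hUH
  (or_intror (mact W (UE m d u q r) = 0) induced_UF).
have RVW := mact_biproduct_Rmx hr hq hH hUH
  (or_introl (mact W (UF m d u q r) = 0) induced_UE).
have Rtwist := D_act_R_mx (actK V) (actX V) (actU_sqr hr W) (@actU_commK _ _ _ _ _ _ _ _ W)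
  (actU_commX hr W).
move=> mV; rewrite -(mueger_dbl hH mV (twist hr W)) !braidingE !(mact_Rmx hH).
rewrite (nmod_actK (nenciu_mx_dbl (nenciu_mx_act V))).
rewrite (nmod_actX (nenciu_mx_dbl (nenciu_mx_act V))).
rewrite RWV RVW.
rewrite (twist_actK hr induced) induced_twistX induced_K induced_X.
(* Only the right-hand side, the double braiding over H, is rewritten, so that both sides contain
   the R-matrix on [W ⊗ V']. *)
rewrite [X in _ = X *m _](_ : _ = swap_mx C p (n + n) *m
  (D_act n (actU W) *
   R_mx m u z alpha Zp Zm (actK (Hrestrict W)) (actX (Hrestrict W))
     (fun a => dbl_even (actK V a)) (fun j => dbl_odd (actX V j)) *
   D_act n (actU W))); last by rewrite Rtwist twist_actK twist_actX.
rewrite induced_UK D_mx_induced.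
have := swap_D_mx q r (dbl_sgn n) (mact W (UK m d u q r)).
rewrite D_mx_induced -!mulmxE.
move: (R_mx _ _ _ _ _ _ _ _ _ _) => M1.
move: (R_mx _ _ _ _ _ _ _ _ _ _) => M2.
move: (D_act _ _) (D_mx _ _ _ _) => D1 D2 SD.
rewrite -!mulmxA; congr (_ *m (_ *m (_ *m _))).
by rewrite !mulmxA; congr (_ *m _).
Qed.
End Braiding.
End Induced.

Theorem proposition6p6 (R : realType)
    (r : nat) (q : R[i]) (hr : (8 %| r)%N) (hq : r.-primitive_root q)
    (s t : nat) (m : 'I_s -> nat) (hm : forall a, (0 < m a)%N)
    (d u : 'M[int]_(t, s)) (hdu : nenciu_matrices R m d u)
    (z : 'M[int]_s) (t2 : nat) (Zp Zm : 'I_t2 -> 'I_t)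
    (L : palg (nenciu R m d u)) (alpha : 'I_t2 -> R[i])
    (H : quasitriangular (nenciu R m d u))
    (hH : nenciu_ribbon H z Zp Zm L alpha)
    (UH : quasitriangular (biproduct m d u q r))
    (hUH : biproduct_quasitriangular UH z Zp Zm L alpha) :
  mueger_nonsemisimple H -> mueger_nonsemisimple UH.
Proof.
case=> V mV nssV; exists (induced hr hq V).
  by move=> W; apply: (braiding_induced hr hq hH hUH W mV).
by move/induced_semisimple.
Qed.
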